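(* Let $k$ be a positive integer and $p$ a prime with $p>k$. Let $C_1,\ldots,C_r$ be cyclic $p$-groups generated by $x_1,\ldots,x_r$ respectively, where $p^{\alpha_i}$ is the order of $x_i$ and $1\leq \alpha_1 \leq \alpha_2 \leq \cdots \leq \alpha_r$. Let $G$ be the $k$-nilpotent product of $C_1,\ldots,C_r$. Then $G$ is capable if and only if $r>1$ and $\alpha_{r-1}=\alpha_r$.
   Context: A group $G$ is capable if there exists a group $H$ with $G\cong H/Z(H)$, where $Z(H)$ is the center of $H$. The lower central series of a group $F$ is $F_1=F$, $F_{n+1}=[F_n,F]$; a group is nilpotent of class at most $k$ if its $(k+1)$-st lower central term is trivial. For groups $A_1,\ldots,A_n$ nilpotent of class at most $k$, their $k$-nilpotent product is $F/F_{k+1}$, where $F=A_1*\cdots*A_n$ is the free product (so it is the coproduct in the category of groups nilpotent of class at most $k$). *)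

(* Defs.v *)
From HB Require Import structures.
From mathcomp Require Import all_boot.
From mathcomp Require Import boolp classical_sets.

Set Implicit Arguments.
Unset Strict Implicit.
Unset Printing Implicit Defensive.

Local Open Scope quotient_scope.
Local Open Scope group_scope.
Local Open Scope classical_set_scope.

(* groupType is used instead of {group gT}: free products are infinite, and the
   group H witnessing capability is arbitrary. *)

Section Subgroups.
Variable G : groupType.
Implicit Types (A B N : set G) (x y z : G).

Definition is_subgroup A : Prop :=
  [/\ A 1, (forall x y, A x -> A y -> A (x * y)) & (forall x, A x -> A x^-1)].

Definition is_normal N : Prop :=
  is_subgroup N /\ (forall x y, N x -> N (x ^ y)).

Definition generated A : set G := smallest is_subgroup A.

Definition commutator_subgroup A B : set G :=
  generated [set z | exists x y, [/\ A x, B y & z = [~ x, y]]].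

Definition center : set G := [set x | forall y, x * y = y * x].

(* lower_central n is the n-th term G_n of the lower central series, with G_1 = G;
   the index 0 is unused and also gives G. *)
Definition lower_central n : set G :=
  iter n.-1 (fun A => commutator_subgroup A setT) setT.

Lemma is_subgroup_generated A : is_subgroup (generated A).
Proof.
split=> [B [[]] // | x y Ax Ay B HB | x Ax B HB].
- by have [_ BM _] := HB.1; apply: BM; [apply: Ax | apply: Ay].
- by have [_ _ BV] := HB.1; apply: BV; apply: Ax.
Qed.

Lemma is_normal_generated A :
  (forall x y, A x -> A (x ^ y)) -> is_normal (generated A).
Proof.
move=> AJ; split; first exact: is_subgroup_generated.
have [g1 gM gV] := is_subgroup_generated A.
move=> x y gx; apply: (gx [set z | generated A (z ^ y)]); split=> [|z Az].
  split=> [|u v|u] /=; rewrite ?conj1g ?conjMg ?conjVg //; first exact: gM.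
  exact: gV.
by move=> B [_ AB]; apply/AB/AJ.
Qed.

Lemma is_normal_center : is_normal center.
Proof.
split; last by move=> x y Zx; rewrite conjgE Zx mulKg.
split=> [y | x y Zx Zy z | x Zx y] /=.
- by rewrite mul1g mulg1.
- by rewrite -mulgA (Zy z) mulgA (Zx z) -mulgA.
- by apply: (mulgI x); rewrite mulVKg mulgA (Zx y) mulgK.
Qed.

Lemma is_normal_lower_central n : is_normal (lower_central n).
Proof.
rewrite /lower_central; elim: n.-1 => [|m [_ IH]] //=.
apply: is_normal_generated => _ y [u [v [Lu _ ->]]].
by exists (u ^ y), (v ^ y); split; [exact: IH | | rewrite conjRg].
Qed.

End Subgroups.

Record normal_subgroup (G : groupType) := NormalSubgroup {
  normal_set : set G;
  normal_setP : is_normal normal_set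
}.

Definition centerN (G : groupType) : normal_subgroup G :=
  NormalSubgroup (is_normal_center G).

Definition lower_centralN (G : groupType) n : normal_subgroup G :=
  NormalSubgroup (is_normal_lower_central G n).

Section QuotientGroup.
Variables (G : groupType) (N : normal_subgroup G).

Definition coset_eq (x y : G) : bool := `[< normal_set N (x^-1 * y) >].

Lemma coset_eq_equiv : equiv_class_of coset_eq.
Proof.
have [[N1 NM NV] _] := normal_setP N.
have sym x y : coset_eq x y -> coset_eq y x.
  by move=> /asboolP/NV; rewrite invgM invgK => ?; apply/asboolP.
split=> [x | x y | y x z /asboolP xy /asboolP yz].
- by apply/asboolP; rewrite mulVg.
- by apply/idP/idP; apply: sym.
- apply/asboolP; have -> : x^-1 * z = (x^-1 * y) * (y^-1 * z).
    by rewrite -mulgA mulVKg.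
  exact: NM.
Qed.

Canonical coset_equiv := EquivRelPack coset_eq_equiv.

Definition quotient_group := {eq_quot coset_eq}.
HB.instance Definition _ := Choice.on quotient_group.

Local Notation pi := (\pi_{eq_quot coset_eq} : G -> quotient_group).

Definition quot_one : quotient_group := pi 1.
Definition quot_inv (u : quotient_group) : quotient_group := pi (repr u)^-1.
Definition quot_mul (u v : quotient_group) : quotient_group :=
  pi (repr u * repr v).

Lemma quot_eqP x y : pi x = pi y <-> normal_set N (x^-1 * y).
Proof. by split=> [/eqmodP/asboolP|H]; last apply/eqmodP/asboolP. Qed.

Lemma repr_pi x : normal_set N (x^-1 * repr (pi x)).
Proof. by apply/quot_eqP; rewrite reprK. Qed.

Lemma quot_mulE x y : quot_mul (pi x) (pi y) = pi (x * y).
Proof.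
have [[_ NM NV] NJ] := normal_setP N.
apply/esym/quot_eqP; rewrite invgM.
have -> : y^-1 * x^-1 * (repr (pi x) * repr (pi y))
        = (x^-1 * repr (pi x)) ^ y * (y^-1 * repr (pi y)).
  by rewrite conjgE !mulgA mulgK.
by apply: NM; [apply: NJ|]; apply: repr_pi.
Qed.

Lemma quot_invE x : quot_inv (pi x) = pi x^-1.
Proof.
have [[_ NM NV] NJ] := normal_setP N.
apply/quot_eqP; rewrite invgK.
have := NJ _ x^-1 (repr_pi x).
by rewrite conjgE invgK !mulgA mulgV mul1g.
Qed.

Lemma quot_mulA : associative quot_mul.
Proof.
move=> u v w; rewrite -[u]reprK -[v]reprK -[w]reprK.
rewrite (quot_mulE (repr v)) (quot_mulE (repr u) (repr v)).
by rewrite !quot_mulE mulgA.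
Qed.

Lemma quot_mul1 : left_id quot_one quot_mul.
Proof. by move=> u; rewrite -[u]reprK /quot_one quot_mulE mul1g. Qed.

Lemma quot_mulr1 : right_id quot_one quot_mul.
Proof. by move=> u; rewrite -[u]reprK /quot_one quot_mulE mulg1. Qed.

Lemma quot_mulV : left_inverse quot_one quot_inv quot_mul.
Proof. by move=> u; rewrite -[u]reprK quot_invE quot_mulE mulVg. Qed.

Lemma quot_mulrV : right_inverse quot_one quot_inv quot_mul.
Proof. by move=> u; rewrite -[u]reprK quot_invE quot_mulE mulgV. Qed.

HB.instance Definition _ := isGroup.Build quotient_group
  quot_mulA quot_mul1 quot_mulr1 quot_mulV quot_mulrV.

End QuotientGroup.

Definition group_isomorphic (G H : groupType) : Prop :=
  exists f : {multiplicative G -> H}, bijective f.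

Definition capable (G : groupType) : Prop :=
  exists H : groupType, group_isomorphic G (quotient_group (centerN H)).

(* The free product of the A i: words whose letters are elements of the A i,
   modulo the congruence that multiplies two adjacent letters from the same
   factor and deletes identity letters. *)
Section FreeProduct.
Variables (I : choiceType) (A : I -> groupType).

Definition word := seq {i : I & A i}.

Inductive word_eq : word -> word -> Prop :=
| word_eq_refl u : word_eq u u
| word_eq_sym u v : word_eq u v -> word_eq v u
| word_eq_trans u v w : word_eq u v -> word_eq v w -> word_eq u w
| word_eq_cat u u' v v' :
    word_eq u u' -> word_eq v v' -> word_eq (u ++ v) (u' ++ v')
| word_eq_one i : word_eq [:: existT (fun i => A i) i 1] [::]
| word_eq_mul i (a b : A i) :
    word_eq [:: existT (fun i => A i) i a; existT (fun i => A i) i b]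
            [:: existT (fun i => A i) i (a * b)].

Definition word_inv (u : word) : word :=
  rev [seq existT (fun i => A i) (tag l) (tagged l)^-1 | l <- u].

Lemma word_inv_cat u v : word_inv (u ++ v) = word_inv v ++ word_inv u.
Proof. by rewrite /word_inv map_cat rev_cat. Qed.

Lemma word_invK : involutive word_inv.
Proof.
elim=> [|[i a] u IH] //; rewrite -cat1s word_inv_cat word_inv_cat IH.
by rewrite /word_inv /rev /= invgK.
Qed.

Lemma word_eq_inv u v : word_eq u v -> word_eq (word_inv u) (word_inv v).
Proof.
elim=> {u v} [u|u v _|u v w _ IHu _ IHv|u u' v v' _ IHu _ IHv|i|i a b].
- exact: word_eq_refl.
- exact: word_eq_sym.
- exact: word_eq_trans IHu IHv.
- by rewrite !word_inv_cat; apply: word_eq_cat.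
- by rewrite /word_inv /rev /= invg1; apply: word_eq_one.
- by rewrite /word_inv /rev /= invgM; apply: word_eq_mul.
Qed.

Lemma word_eq_catV u : word_eq (u ++ word_inv u) [::].
Proof.
elim: u => [|[i a] u IH]; first exact: word_eq_refl.
rewrite -cat1s word_inv_cat catA -(catA [:: _] u).
apply: (@word_eq_trans _ ([:: existT _ i a] ++ word_inv [:: existT _ i a])).
  apply: word_eq_cat; last exact: word_eq_refl.
  rewrite -[X in word_eq _ X]cats0; apply: word_eq_cat IH.
  exact: word_eq_refl.
rewrite /word_inv /rev /=; apply: word_eq_trans (word_eq_mul _ _) _.
by rewrite mulgV; apply: word_eq_one.
Qed.

Definition word_eqb (u v : word) : bool := `[< word_eq u v >].

Lemma word_eqb_equiv : equiv_class_of word_eqb.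
Proof.
have sym u v : word_eqb u v -> word_eqb v u.
  by move=> /asboolP/word_eq_sym ?; apply/asboolP.
split=> [u | u v | v u w /asboolP uv /asboolP vw].
- exact/asboolP/word_eq_refl.
- by apply/idP/idP; apply: sym.
- exact/asboolP/(word_eq_trans uv vw).
Qed.

Canonical word_equiv := EquivRelPack word_eqb_equiv.

Definition free_product := {eq_quot word_eqb}.
HB.instance Definition _ := Choice.on free_product.

Local Notation pi := (\pi_{eq_quot word_eqb} : word -> free_product).

Definition fp_one : free_product := pi [::].
Definition fp_inv (x : free_product) : free_product := pi (word_inv (repr x)).
Definition fp_mul (x y : free_product) : free_product := pi (repr x ++ repr y).

Lemma fp_eqP u v : pi u = pi v <-> word_eq u v.
Proof. by split=> [/eqmodP/asboolP|H]; last apply/eqmodP/asboolP. Qed.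

Lemma fp_repr u : word_eq (repr (pi u)) u.
Proof. by apply/fp_eqP; rewrite reprK. Qed.

Lemma fp_mulE u v : fp_mul (pi u) (pi v) = pi (u ++ v).
Proof. by apply/fp_eqP/word_eq_cat; apply: fp_repr. Qed.

Lemma fp_invE u : fp_inv (pi u) = pi (word_inv u).
Proof. exact/fp_eqP/word_eq_inv/fp_repr. Qed.

Lemma fp_mulA : associative fp_mul.
Proof.
move=> x y z; rewrite -[x]reprK -[y]reprK -[z]reprK.
by rewrite (fp_mulE (repr y)) (fp_mulE (repr x) (repr y)) !fp_mulE catA.
Qed.

Lemma fp_mul1 : left_id fp_one fp_mul.
Proof. by move=> x; rewrite -[x]reprK /fp_one fp_mulE. Qed.

Lemma fp_mulr1 : right_id fp_one fp_mul.
Proof. by move=> x; rewrite -[x]reprK /fp_one fp_mulE cats0. Qed.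

Lemma fp_mulrV : right_inverse fp_one fp_inv fp_mul.
Proof.
by move=> x; rewrite -[x]reprK fp_invE fp_mulE; apply/fp_eqP/word_eq_catV.
Qed.

Lemma fp_mulV : left_inverse fp_one fp_inv fp_mul.
Proof.
move=> x; rewrite -[x]reprK fp_invE fp_mulE; apply/fp_eqP.
by rewrite -{2}[repr x]word_invK; apply: word_eq_catV.
Qed.

HB.instance Definition _ := isGroup.Build free_product
  fp_mulA fp_mul1 fp_mulr1 fp_mulV fp_mulrV.

End FreeProduct.

Definition nilpotent_product (k : nat) (I : choiceType) (A : I -> groupType) :
    groupType :=
  quotient_group (lower_centralN (free_product A) k.+1).

(* Main.v *)
From Pilot Require Import Defs.
From mathcomp Require Import all_boot all_fingroup.
From HB Require Import structures.
From mathcomp Require Import cyclic all_algebra.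
From mathcomp Require Import boolp classical_sets.
Import Pilot.Defs GRing.Theory.

(** Only if.  Let N = p^a be the largest of the orders of the generators other
    than x_r.  If the nilpotent product is H/Z(H), then H has class at most
    k + 1 <= p, and every lift y of another generator has y^N central.  In a
    group of class at most p this forces y to commute with all N-th powers: by
    the Hall-Petrescu formula, (uv)^N and u^N v^N differ by c_j^C(N, j) with
    2 <= j < p and c_j in the j-th term of the lower central series of <u, v>,
    and N divides C(N, j).  Hence x_r^N lifts to a central element, so x_r^N = 1.

    If.  Represent x_i by the truncated exponential of a noncommuting variable
    X_i, in the algebra where words have length at most k + 1 and a word is killed
    by the least order of its letters.  The order p^(alpha i) power of this unit
    is central, since it is 1 up to degree k.  Let H be the group generated by
    these units.  An element of the n-th lower central term of the free product,
    n <= k, acts in degree n by a Lie polynomial s.  If it is sent into Z(H), then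
    s commutes with X_r and X_(r-1); as these have the same order, this kills all
    coefficients of s.  But the Dynkin map sends s to the n-th power of the
    element, so the element lies in the next lower central term because n < p. *)

Set Implicit Arguments.
Unset Strict Implicit.
Unset Printing Implicit Defensive.

Local Open Scope group_scope.

(** * Lower central series *)

Section CommutatorIdentities.
Local Open Scope classical_set_scope.
Variable G : groupType.
Implicit Types x y z : G.

Lemma commMg x y z : [~ x * y, z] = [~ x, z] ^ y * [~ y, z].
Proof. by rewrite /commg /conjg !gnorm. Qed.

Lemma commgM x y z : [~ x, y * z] = [~ x, z] * [~ x, y] ^ z.
Proof. by rewrite /commg /conjg !gnorm. Qed.

Lemma commVg x y : [~ x^-1, y] = [~ x, y]^-1 ^ x^-1.
Proof. by rewrite /commg /conjg !gnorm. Qed.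

Lemma commgV x y : [~ x, y^-1] = [~ x, y]^-1 ^ y^-1.
Proof. by rewrite /commg /conjg !gnorm. Qed.

Lemma conjg_commg x y : x ^ y = x * [~ x, y].
Proof. by rewrite /commg /conjg !gnorm. Qed.

(** This computes the difference of a sequence of commutators, with [a] and [b] the increments of
    its two entries. Each of the three factors is a commutator involving an increment, hence one
    term deeper in the series than [[~ x, y]]. *)
Lemma commg_diff x a y b : [~ x, y]^-1 * [~ x * a, y * b] =
  ([~ x, b] ^ a) ^ [~ x, y] * [~ [~ x, y], b * a] * [~ a, y * b].
Proof. by rewrite /commg /conjg !gnorm. Qed.

Lemma Hall_Witt x y z :
  [~ [~ x, y^-1], z] ^ y * [~ [~ y, z^-1], x] ^ z * [~ [~ z, x^-1], y] ^ x = 1.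
Proof. by rewrite /commg /conjg !gnorm. Qed.

End CommutatorIdentities.

Section Subgroup.
Local Open Scope classical_set_scope.
Variable G : groupType.
Implicit Types (A B : set G) (x y z : G).

Lemma generated_min A B : is_subgroup B -> A `<=` B -> generated A `<=` B.
Proof. by move=> sB AB x; apply. Qed.

Lemma sub_generated A : A `<=` generated A.
Proof. by move=> x Ax B [_]; apply. Qed.

Lemma subgroupJ A x y : is_subgroup A -> A x -> A y -> A (x ^ y).
Proof. by case=> _ AM AV Ax Ay; apply: (AM) (AV _ Ay) (AM _ _ Ax Ay). Qed.

Lemma subgroupR A x y : is_subgroup A -> A x -> A y -> A [~ x, y].
Proof.
by move=> sA Ax Ay; have [_ AM AV] := sA; apply: AM (AV _ Ax) (subgroupJ sA _ _).
Qed.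

Lemma subgroupX A x n : is_subgroup A -> A x -> A (x ^+ n).
Proof.
case=> A1 AM _ Ax; elim: n => [|n IH]; first by rewrite expg0.
by rewrite expgS; apply: AM.
Qed.

Lemma subgroupT : is_subgroup (setT : set G).
Proof. by split. Qed.

Lemma generatedJ A B : (forall x y, B y -> A x -> A (x ^ y)) ->
  forall x y, B y -> generated A x -> generated A (x ^ y).
Proof.
move=> AJ x y By gx; have [g1 gM gV] := is_subgroup_generated A.
apply: (gx [set z | generated A (z ^ y)]); split=> [|z Az]; last first.
  by apply: sub_generated; apply: AJ.
split=> [|u v|u] /=; rewrite ?conj1g ?conjMg ?conjVg //; first exact: gM.
exact: gV.
Qed.

End Subgroup.

(* [lower_central n] is [lcs setT n]. *)
Definition lcs (G : groupType) (A : set G) n : set G :=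
  iter n.-1 (fun B => commutator_subgroup B A) A.

Section LowerCentralSeries.
Local Open Scope classical_set_scope.
Variables (G : groupType) (A : set G).
Hypothesis sA : is_subgroup A.
Local Notation L := (lcs A).
Implicit Types x y z : G.

Lemma lcs_subgroup n : is_subgroup (L n).
Proof. by case: n => [|[|n]] //; apply: is_subgroup_generated. Qed.

Lemma lcs1 n : L n 1. Proof. by case: (lcs_subgroup n). Qed.
Lemma lcsM n x y : L n x -> L n y -> L n (x * y).
Proof. by case: (lcs_subgroup n) => _ + _; apply. Qed.
Lemma lcsV n x : L n x -> L n x^-1.
Proof. by case: (lcs_subgroup n) => _ _; apply. Qed.

Lemma lcsJ n x y : A y -> L n x -> L n (x ^ y).
Proof.
move=> Ay; case: n => [|n]; first by move=> Ax; apply: subgroupJ.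
elim: n x y Ay => [|n IH] x y Ay; first by move=> Ax; apply: subgroupJ.
apply: generatedJ Ay => _ {}y Ay [u [v [Lu Av ->]]].
by exists (u ^ y), (v ^ y); split; [exact: IH | exact: subgroupJ | rewrite conjRg].
Qed.

Lemma lcsS n : L n.+1 `<=` L n.
Proof.
case: n => // n; apply: generated_min; first exact: lcs_subgroup.
move=> _ [u [v [Lu Av ->]]]; rewrite commgEl.
by apply: lcsM; [apply: lcsV | apply: lcsJ].
Qed.

Lemma lcs_le m n : (m <= n)%N -> L n `<=` L m.
Proof.
move=> /subnK <-; elim: (n - m)%N => // d IH.
by rewrite addSn; apply: subset_trans IH; apply: lcsS.
Qed.

Lemma lcs_sub n : L n `<=` A.
Proof. exact: (@lcs_le 0). Qed.

Lemma lcsRA n x y : L n x -> A y -> L n.+1 [~ x, y].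
Proof.
by case: n => [|n] Lx Ay; [exact: subgroupR|apply: sub_generated; exists x, y].
Qed.

(** Induction on [n]. For a generator [[~ y, a]] of the next term, the Hall-Witt identity for [y],
    [a^-1], [x] expresses [[~ [~ y, a], x]] through [[~ [~ a^-1, x^-1], y]] and [[~ [~ x, y^-1],
    a^-1]], both covered by induction. *)
Lemma lcsR m n x y : L m x -> L n y -> L (m + n) [~ x, y].
Proof.
elim: n m x y => [|n IH] m x y Lx Ly.
  by rewrite addn0; apply/lcsS/lcsRA.
case: n IH Ly => [|n] IH; first by rewrite addn1; apply: lcsRA.
(* Membership in [A] is carried along because the terms are only known to be stable under
   conjugation by elements of [A]. *)
move=> Ly; suff: [set z | A z /\ forall m x, L m x -> L (m + n.+2) [~ x, z]] y.
  by case=> _; apply.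
have [A1 AM AV] := sA.
move: y Ly; apply: generated_min => [|_ [y [a [Ly Aa ->]]]] /=.
  split=> [|u v [Au Lu] [Av Lv]|u [Au Lu]].
  - by split=> // *; rewrite commg1; apply: lcs1.
  - split=> [|{Lx} {}m {}x Lx]; first exact: AM.
    by rewrite commgM; apply: lcsM; [exact: Lv|apply/lcsJ=> //; apply: Lu].
  - split=> [|{Lx} {}m {}x Lx]; first exact: AV.
    by rewrite commgV; apply: lcsJ; [apply: AV|apply/lcsV/Lu].
have {}Ly : L n.+1 y by [].
have Ay := lcs_sub Ly; split=> [|{Lx} {}m {}x Lx]; first exact: subgroupR.
have Ax := lcs_sub Lx.
have /(canRL (mulgK _)) := Hall_Witt y a^-1 x; rewrite invgK mul1g.
move=> /(canRL (mulgK _))/(canRL (conjgKV _)) => E.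
rewrite -invgR E; apply: lcsV; apply: lcsJ=> //.
apply: lcsM; apply: lcsV; apply: lcsJ=> //; rewrite addnS -?addSn.
  rewrite addSn; apply: lcsRA; last exact: AV.
  by apply: IH => //; apply: lcsV.
apply: IH => //; rewrite -invgR; apply: lcsV; apply: lcsRA; last exact: AV.
exact: lcsV.
Qed.

End LowerCentralSeries.

Section LowerCentral.
Local Open Scope classical_set_scope.
Variable G : groupType.
Local Notation gamma := (@lower_central G).
Implicit Types x y : G.
Let sT := @subgroupT G.

Lemma lower_central_subgroup n : is_subgroup (gamma n).
Proof. exact: (lcs_subgroup sT n). Qed.

Lemma lower_central1 n : gamma n 1. Proof. exact: (lcs1 sT n). Qed.
Lemma lower_centralM n x y : gamma n x -> gamma n y -> gamma n (x * y).
Proof. exact: (@lcsM _ _ sT n). Qed.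
Lemma lower_centralV n x : gamma n x -> gamma n x^-1.
Proof. exact: (@lcsV _ _ sT n). Qed.
Lemma lower_centralJ n x y : gamma n x -> gamma n (x ^ y).
Proof. exact: (@lcsJ _ _ sT n). Qed.
Lemma lower_central_le m n : (m <= n)%N -> gamma n `<=` gamma m.
Proof. exact: (@lcs_le _ _ sT m n). Qed.
Lemma lower_centralR m n x y : gamma m x -> gamma n y -> gamma (m + n) [~ x, y].
Proof. exact: (@lcsR _ _ sT m n). Qed.
Lemma lower_centralRT n x y : gamma n x -> gamma n.+1 [~ x, y].
Proof. by move=> Gx; apply: (@lcsRA _ _ sT n). Qed.

End LowerCentral.

(** * Polynomial sequences in nilpotent groups *)

Section PolynomialSequences.
Local Open Scope classical_set_scope.
Variables (G : groupType) (A : set G).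
Hypothesis sA : is_subgroup A.
Local Notation L := (lcs A).
Implicit Types (f g : nat -> G) (x y z : G).

Definition step f n := (f n)^-1 * f n.+1.

(* The m-th difference of f takes values in L (i + m), for all m < d. *)
Fixpoint polyseq d i f : Prop :=
  if d is d'.+1 then (forall n, L i (f n)) /\ polyseq d' i.+1 (step f)
  else True.

Lemma polyseqW d i f : polyseq d.+1 i f -> polyseq d i f.
Proof. by elim: d i f => // d IH i f [Lf /IH]. Qed.

Lemma polyseqS d i f : polyseq d i.+1 f -> polyseq d i f.
Proof.
elim: d i f => // d IH i f [Lf Pf]; split=> [n|]; last exact: IH.
exact: (lcsS sA).
Qed.

Lemma polyseq_le d i j f : (i <= j)%N -> polyseq d j f -> polyseq d i f.
Proof.
move=> /subnK <-; elim: (j - i)%N => // e IH.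
by rewrite addSn => /polyseqS.
Qed.

(** The three closures are proved together: conjugation [f ^ g = f * [~ f, g]] enters the
    differences of products and inverses, and products enter the difference of a commutator. Each
    difference has one level less to check, so induction on [d] applies. *)
Lemma polyseq_closed d :
  [/\ forall i f g, polyseq d i f -> polyseq d i g ->
        polyseq d i (fun n => f n * g n),
      forall i f, polyseq d i f -> polyseq d i (fun n => (f n)^-1) &
      forall i j f g, polyseq d i f -> polyseq d j g ->
        polyseq d (i + j) (fun n => [~ f n, g n])].
Proof.
elim: d => [|d [IHM IHV IHR]]; first by split.
have IHJ i f g : polyseq d i f -> polyseq d 0 g -> polyseq d i (fun n => f n ^ g n).
  move=> Pf Pg.
  have -> : (fun n => f n ^ g n) = (fun n => f n * [~ f n, g n]).
    by apply: funext => n; rewrite conjg_commg.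
  by apply: IHM => //; rewrite -(addn0 i); apply: IHR.
split.
- move=> i f g Pf Pg; have [[Lf Df] [Lg Dg]] := (Pf, Pg); split=> [n|].
    exact: lcsM.
  have -> : step (fun n => f n * g n) = (fun n => step f n ^ g n * step g n).
    apply: funext => n; rewrite /step conjgE invgM !mulgA mulgK.
    by rewrite -!mulgA.
  apply: IHM => //; apply: IHJ => //.
  exact: (polyseq_le (leq0n i) (polyseqW Pg)).
- move=> i f Pf; have [Lf Df] := Pf; split=> [n|]; first exact: lcsV.
  have -> : step (fun n => (f n)^-1) = (fun n => (step f n)^-1 ^ (f n)^-1).
    by apply: funext => n; rewrite /step conjgE invgM !invgK !mulgA mulgK.
  apply: IHJ; first exact: IHV.
  exact/IHV/(polyseq_le (leq0n i))/polyseqW.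
- move=> i j f g Pf Pg; have [[Lf Df] [Lg Dg]] := (Pf, Pg).
  have {Pf Pg} [Pf Pg] := (polyseqW Pf, polyseqW Pg).
  split=> [n|]; first exact: lcsR.
  pose a := step f; pose b := step g; pose q n := [~ f n, g n].
  have -> : step (fun n => [~ f n, g n]) = (fun n =>
      ([~ f n, b n] ^ a n) ^ q n * [~ q n, b n * a n] * [~ a n, g n * b n]).
    apply: funext => n; rewrite {1}/step.
    have -> : f n.+1 = f n * a n by rewrite /a /step mulVKg.
    have -> : g n.+1 = g n * b n by rewrite /b /step mulVKg.
    exact: commg_diff.
  have P0 e k h : polyseq e k h -> polyseq e 0 h by apply: polyseq_le.
  have Pq : polyseq d (i + j) q by apply: IHR.
  have Pa : polyseq d 1 a by apply: polyseq_le Df.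
  have Pb : polyseq d 1 b by apply: polyseq_le Dg.
  have P1 : polyseq d (i + j).+1 (fun n => ([~ f n, b n] ^ a n) ^ q n).
    apply: (IHJ) (P0 _ _ _ Pq); apply: (IHJ) (P0 _ _ _ Pa).
    by rewrite -addnS; apply: IHR.
  have P2 : polyseq d (i + j).+1 (fun n => [~ q n, b n * a n]).
    by rewrite -addn1; apply: IHR => //; apply: IHM.
  have P3 : polyseq d (i + j).+1 (fun n => [~ a n, g n * b n]).
    by rewrite -addSn; apply: IHR => //; apply: IHM => //; apply: polyseqS.
  exact: IHM (IHM _ _ _ P1 P2) P3.
Qed.

Lemma polyseqM d i f g : polyseq d i f -> polyseq d i g ->
  polyseq d i (fun n => f n * g n).
Proof. by case: (polyseq_closed d) => + _ _; apply. Qed.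

Lemma polyseqV d i f : polyseq d i f -> polyseq d i (fun n => (f n)^-1).
Proof. by case: (polyseq_closed d) => _ + _; apply. Qed.

Lemma step_cst x : step (fun=> x) = fun=> 1.
Proof. by apply: funext => n; rewrite /step mulVg. Qed.

Lemma polyseq1 d i : polyseq d i (fun=> 1).
Proof.
by elim: d i => // d IH i; split=> [n|]; [exact: lcs1|rewrite step_cst].
Qed.

Lemma polyseqX d i j x : L (i + j) x -> polyseq d i (fun n => x ^+ 'C(n, j)).
Proof.
elim: d i j => // d IH i [|j] Lx.
  split=> [n|]; first by rewrite bin0 expg1; rewrite addn0 in Lx.
  have -> : (fun n => x ^+ 'C(n, 0)) = fun=> x.
    by apply: funext => n; rewrite bin0.
  by rewrite step_cst; apply: polyseq1.
split=> [n|].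
  by apply: subgroupX; [exact: lcs_subgroup|apply: lcs_le Lx => //; exact: leq_addr].
have -> : step (fun n => x ^+ 'C(n, j.+1)) = fun n => x ^+ 'C(n, j).
  by apply: funext => n; rewrite /step binS expgnDr mulKg.
by apply: IH; rewrite addSnnS.
Qed.

Lemma iter_step_polyseq d i f n : polyseq d.+1 i f -> L (i + d) (iter d step f n).
Proof.
elim: d i f => [|d IH] i f [Lf Pf]; first by rewrite addn0; apply: Lf.
by rewrite iterSr -addSnnS; apply: IH.
Qed.

Lemma iter_step0 j f : (forall n, (n < j)%N -> f n = 1) ->
  iter j step f 0 = f j.
Proof.
elim: j f => // j IH f f1; rewrite iterSr IH => [|n nj].
  by rewrite /step f1 // invg1 mul1g.
by rewrite /step !f1 ?mulVg // ltnW.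
Qed.

(** As for polynomials of degree below [d], a sequence with trivial [d]-th difference is determined
    by its first [d] values. *)
Lemma iter_step_eq1 d f : (forall n, (n < d)%N -> f n = 1) ->
  (forall n, iter d step f n = 1) -> forall n, f n = 1.
Proof.
elim: d f => // d IH f f1 Df1.
have D1 n : step f n = 1.
  apply: IH n => n; last by rewrite -iterSr.
  by move=> nd; rewrite /step !f1 ?mulVg // ltnW.
elim=> [|n IHn]; first exact: f1.
by have := D1 n; rewrite /step IHn invg1 mul1g.
Qed.

Section PrimePower.
Variables (p a : nat).
Hypotheses (p_prime : prime p) (Lp1 : L p `<=` [set 1]).
Hypothesis expL2 : forall x, L 2 x -> x ^+ (p ^ a) = 1.

(** From [j * 'C(p ^ a, j) = p ^ a * 'C(p ^ a - 1, j - 1)], where [j] is prime to [p]. *)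
Lemma dvdn_bin_prime_power j : (0 < j < p)%N -> (p ^ a %| 'C(p ^ a, j))%N.
Proof.
case: j => // j /= jp; have cop : coprime (p ^ a) j.+1.
  by rewrite coprimeXl // prime_coprime // gtnNdvd.
rewrite -(Gauss_dvdr _ cop).
by rewrite -mul_bin_diag dvdn_mulr.
Qed.

(* Taylor expansion: dividing f by c^'C(n, j) with c = f j in L j makes it vanish
   at j too. *)
Lemma polyseq_prime_power j f : (2 <= j)%N -> polyseq p.+1 0 f ->
  (forall n, (n < j)%N -> f n = 1) -> f (p ^ a)%N = 1.
Proof.
have [e] := ubnP (p - j); elim: e j f => // e IH j f pje j2 Pf f1.
have [pj|jp] := leqP p j.
  apply: (@iter_step_eq1 p) => [n np|n]; first by apply/f1/(leq_trans np).
  by apply: Lp1; apply: (@iter_step_polyseq p 0).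
pose c := f j; have Lc : L j c.
  rewrite /c -iter_step0 //; apply: (@iter_step_polyseq j 0).
  move: Pf; rewrite -(subnK (ltnW jp)) -addnS; elim: (p - j)%N => // k IHk.
  by rewrite addSn => /polyseqW.
pose g n := (c ^+ 'C(n, j))^-1 * f n.
have: g (p ^ a)%N = 1.
  apply: (IH j.+1) => //; first exact: leq_trans (ltn_sub2l jp (ltnSn j)) pje.
  - exact: leqW.
  - by apply: polyseqM => //; apply/polyseqV/polyseqX.
  - move=> n; rewrite ltnS leq_eqVlt => /predU1P [->|nj].
      by rewrite /g binn expg1 mulVg.
    by rewrite /g bin_small // expg0 invg1 mul1g f1.
have /dvdnP [m Cm] : (p ^ a %| 'C(p ^ a, j))%N.
  by apply: dvdn_bin_prime_power; rewrite jp andbT ltnW.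
rewrite /g Cm mulnC expgnA expL2 ?expg1n ?invg1 ?mul1g //.
exact: lcs_le Lc.
Qed.

(** The Hall-Petrescu argument: the error term [f n] is a product of polynomial sequences and is
    trivial at 0 and 1, so its Taylor expansion starts at the binomial of index 2. *)
Lemma expgMn_prime_power x y : A x -> A y ->
  (x * y) ^+ (p ^ a) = x ^+ (p ^ a) * y ^+ (p ^ a).
Proof.
move=> Ax Ay; have [_ AM AV] := sA.
pose f n := (x ^+ n * y ^+ n)^-1 * (x * y) ^+ n.
suff: f (p ^ a)%N = 1 by move=> /(canRL (mulVKg _)); rewrite mulg1.
apply: (@polyseq_prime_power 2) => //; last first.
  by case=> [|[|]] // _; rewrite /f ?expg0 ?expg1 ?mulg1 ?mulVg ?invg1.
have PX z : A z -> polyseq p.+1 0 (fun n => z ^+ n).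
  move=> Az; have -> : (fun n => z ^+ n) = fun n => z ^+ 'C(n, 1).
    by apply: funext => n; rewrite bin1.
  exact: polyseqX.
by apply: polyseqM; [apply/polyseqV/polyseqM|]; apply: PX => //; apply: AM.
Qed.

End PrimePower.
End PolynomialSequences.

(** * Prime powers in groups of class at most p *)

Section SmallClass.
Local Open Scope classical_set_scope.
Variable G : groupType.
Implicit Types (K S : set G) (x y z g h c : G).
Local Notation gamma := (@lower_central G).

(** Commuting modulo [K] passes to products and inverses, first in one argument and then in the
    other. *)
Lemma commg_generated K S : is_normal K ->
  (forall u v, S u -> S v -> K [~ u, v]) ->
  forall u v, generated S u -> generated S v -> K [~ u, v].
Proof.
move=> [[K1 KM KV] KJ] SK.
have rgen u : (forall v, S v -> K [~ u, v]) ->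
    forall v, generated S v -> K [~ u, v].
  move=> Ku; apply: (@generated_min _ _ [set v | K [~ u, v]]) => //; split=> /=.
  - by rewrite commg1.
  - by move=> v w Kv Kw; rewrite commgM; apply: KM => //; apply: KJ.
  - by move=> v Kv; rewrite commgV; apply/KJ/KV.
move=> u v Su Sv; rewrite -invgR; apply: (KV).
apply: (rgen) Su => w Sw; rewrite -invgR; apply: (KV).
by apply: rgen Sv => t St; apply: SK.
Qed.

(** Once the derived subgroup of [A] sits one term deeper in the series of the whole group, so do
    all later terms. This gives [A] class below [p] when the group has class at most [p]. *)
Lemma lcs_shift A : is_subgroup A -> lcs A 2 `<=` gamma 3 ->
  forall n, (1 < n)%N -> lcs A n `<=` gamma n.+1.
Proof.
move=> sA A23; case=> [|[|n]] // _; elim: n => // n IH.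
apply: generated_min; first exact: lower_central_subgroup.
move=> _ [u [v [/IH Lu _ ->]]]; exact: lower_centralRT.
Qed.

Variables (p a : nat).
Hypotheses (p_prime : prime p) (gamma_p1 : gamma p.+1 `<=` [set 1]).

(** In the subgroup generated by [u] and [v], the second term lies in [gamma 3], so [lcs_shift]
    makes its [p]-th term trivial; it also lies in [K], so it has exponent [p ^ a]. *)
Lemma expgMn_small_class K u v : is_normal K ->
    (forall z, K z -> z ^+ (p ^ a) = 1) -> K [~ u, v] -> gamma 3 [~ u, v] ->
  (u * v) ^+ (p ^ a) = u ^+ (p ^ a) * v ^+ (p ^ a).
Proof.
move=> nK expK Kuv Guv; pose S := [set z | z = u \/ z = v].
pose A := generated S; have sA : is_subgroup A by apply: is_subgroup_generated.
have sub2 M : is_normal M -> M [~ u, v] -> lcs A 2 `<=` M.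
  move=> nM Muv; have [[M1 MM MV] _] := nM.
  apply: generated_min => // _ [s [t [As At ->]]].
  apply: commg_generated At => // {As}s {}t [->|->] [->|->]; rewrite ?commgg //.
  by rewrite -invgR; apply: MV.
apply: (@expgMn_prime_power _ A sA p a p_prime).
- apply: subset_trans gamma_p1; apply: lcs_shift => //; last exact: prime_gt1.
  by apply: sub2 Guv; apply: is_normal_lower_central.
- by move=> z /(sub2 _ nK Kuv)/expK.
- by apply: sub_generated; left.
- by apply: sub_generated; right.
Qed.

Section CentralPower.
Variable x : G.
Hypothesis xN : @center G (x ^+ (p ^ a)).

(** The commutator subgroup of the normal closure of [x] with the [m]-th lower central term. *)
Let E m : set G := generated [set z | exists g h, gamma m h /\ z = [~ x ^ g, h]].

Let nE m : is_normal (E m).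
Proof.
apply: is_normal_generated => _ y [g [h [Gh ->]]].
exists (g * y), (h ^ y); split; last by rewrite conjRg conjgM.
by case: (is_normal_lower_central G m) => _; apply.
Qed.

Let E_gamma m : E m `<=` gamma m.+1.
Proof.
apply: generated_min; first exact: lower_central_subgroup.
move=> _ [g [h [Gh ->]]]; exact: (@lower_centralR _ 1).
Qed.

(** [E m] lies in the normal closure of [x], since [[~ x ^ g, h0]] is a quotient of two conjugates
    of [x]; and conjugates of [x] satisfy the claim by definition of [E n]. *)
Let commEgamma m n c h : E m c -> gamma n h -> E n [~ c, h].
Proof.
move=> Ec Gh; have [[E1 EM EV] EJ] := nE n.
pose D := [set c | E n [~ c, h]]; have sD : is_subgroup D.
  split=> [|u v Du Dv|u Du]; rewrite /D /=.
  - by rewrite comm1g.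
  - by rewrite commMg; apply: EM => //; apply: EJ.
  - by rewrite commVg; apply: EJ; apply: EV.
have Dx g : D (x ^ g) by apply: sub_generated; exists g, h.
move: c Ec; apply: (generated_min sD) => _ [g [h0 [_ ->]]].
case: sD => _ DM DV; rewrite commgEl -conjgM; exact: DM (DV _ (Dx _)) (Dx _).
Qed.

(* Descending induction on m.  For e = [x^g, h] the elements x^g * e and x^g are
   conjugate, so they have the same central p^a-th power. *)
Let expE m c : (0 < m)%N -> E m c -> c ^+ (p ^ a) = 1.
Proof.
have [e] := ubnP (p - m); elim: e m c => // e IH m c pme m0 Ec.
have [pm|mp] := leqP p m.
  suff -> : c = 1 by rewrite expg1n.
  by apply/gamma_p1/(lower_central_le _ (E_gamma Ec)).
have {IH} expS z : E m.+1 z -> z ^+ (p ^ a) = 1.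
  by apply: IH => //; apply: leq_trans (ltn_sub2l mp (ltnSn m)) pme.
have G3 : E m.+1 `<=` gamma 3.
  by apply: subset_trans (@E_gamma _) _; apply: lower_central_le.
suff: E m `<=` [set c | E m c /\ c ^+ (p ^ a) = 1] by move=> /(_ c Ec) [].
have [[E1 EM EV] EJ] := nE m.
apply: generated_min => [|_ [g [h [Gh ->]]]].
  split=> [|u v [Eu uN] [Ev vN]|u [Eu uN]] /=; rewrite ?expg1n //.
  - split; first exact: EM.
    have Euv : E m.+1 [~ u, v] by apply: commEgamma Eu _; apply: E_gamma.
    by rewrite (expgMn_small_class (nE m.+1)) ?uN ?vN ?mulg1 //; apply: G3.
  - by rewrite expVgn uN invg1; split=> //; apply: EV.
have Ee : E m [~ x ^ g, h] by apply: sub_generated; exists g, h.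
split=> //; set e1 := [~ _, _] in Ee *.
have Exe : E m.+1 [~ x ^ g, e1].
  by apply: sub_generated; exists g, e1; split=> //; apply: E_gamma.
have := expgMn_small_class (nE m.+1) expS Exe (G3 _ Exe).
rewrite /e1 -conjg_commg -!conjXg.
have xJ y : (x ^+ (p ^ a)) ^ y = x ^+ (p ^ a) by rewrite conjgE xN mulKg.
by rewrite !xJ -[LHS]mulg1 => /mulgI <-.
Qed.

(** Since [y ^ x = y * [~ y, x]] and [[~ y, x]] has trivial [p ^ a]-th power by [expE], the powers
    of [y ^ x] and [y] agree, so [x] centralizes [y ^+ (p ^ a)]. *)
Lemma commute_prime_power y : commute x (y ^+ (p ^ a)).
Proof.
have [[E1 EM EV] EJ] := nE 1.
have Ec : E 1 [~ y, x].
  by rewrite -invgR; apply: EV; apply: sub_generated; exists 1, y; rewrite conjg1.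
have Eyc : E 1 [~ y, [~ y, x]] by rewrite commgEr; apply: EM => //; apply: EJ; apply: EV.
have Gyc : gamma 3 [~ y, [~ y, x]].
  by apply: (@lower_centralR _ 1 2) => //; apply: E_gamma.
have := expgMn_small_class (nE 1) (@expE 1 ^~ isT) Eyc Gyc.
rewrite -conjg_commg (expE _ Ec) // mulg1 -conjXg => /conjg_fixP/commgP.
exact: commute_sym.
Qed.

End CentralPower.
End SmallClass.

(** * Quotients and free products *)

Notation "{ 'hom' G -> H }" := (UMagmaMorphism.type G H)
  (at level 0, G at level 98, H at level 99) : type_scope.

Section Hom.
Local Open Scope classical_set_scope.
Variables (G H : groupType) (f : G -> H).
Hypothesis fM : {morph f : x y / x * y}.

Lemma morph_divg x y : f (x * y^-1) = f x * (f y)^-1.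
Proof.
by apply: (mulIg (f y)); rewrite -fM !mulgVK.
Qed.

HB.instance Definition _ := isGroupMorphism.Build G H f morph_divg.
Definition hom_of : {hom G -> H} := f.

End Hom.

Section QuotientMap.
Local Open Scope classical_set_scope.
Variables (G : groupType) (N : normal_subgroup G).

Definition quot_map (x : G) : quotient_group N :=
  \pi_({eq_quot (coset_eq N)})%qT x.

Lemma quot_mapM : {morph quot_map : x y / x * y}.
Proof. by move=> x y; rewrite [RHS](quot_mulE N). Qed.

HB.instance Definition _ :=
  isGroupMorphism.Build G (quotient_group N) quot_map (morph_divg quot_mapM).

Lemma quot_map_eqP x y : quot_map x = quot_map y <-> normal_set N (x^-1 * y).
Proof. exact: quot_eqP. Qed.

Lemma quot_map_eq1 x : quot_map x = 1 <-> normal_set N x.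
Proof.
have [[N1 NM NV] _] := normal_setP N.
have <- : quot_map 1 = 1 by apply: gmulf1.
rewrite quot_map_eqP mulg1.
by split=> /NV; rewrite ?invgK.
Qed.

Lemma quot_map_surj u : exists x, quot_map x = u.
Proof. by exists (generic_quotient.repr u); rewrite /quot_map reprK. Qed.

End QuotientMap.

Section FreeProductUniversal.
Local Open Scope classical_set_scope.
Variables (I : choiceType) (A : I -> groupType).
Local Notation F := (free_product A).

Definition letter i (a : A i) : F :=
  \pi_({eq_quot (@word_eqb I A)})%qT [:: existT (fun i => A i) i a].

Lemma letterM i : {morph @letter i : a b / a * b}.
Proof.
move=> a b; rewrite [RHS]fp_mulE; apply/fp_eqP/word_eq_sym; exact: word_eq_mul.
Qed.

HB.instance Definition _ i :=
  isGroupMorphism.Build (A i) F (@letter i) (morph_divg (@letterM i)).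

Lemma free_product_ind (S : set F) : is_subgroup S ->
  (forall i (a : A i), S (letter a)) -> forall g, S g.
Proof.
case=> S1 SM _ SA g; rewrite -[g]reprK; elim: (generic_quotient.repr g) => [|[i a] w IH] //.
have -> : \pi_({eq_quot (@word_eqb I A)})%qT (existT _ i a :: w) =
          letter a * \pi_({eq_quot (@word_eqb I A)})%qT w.
  by rewrite [RHS]fp_mulE.
exact: SM.
Qed.

Variables (T : groupType) (f : forall i, {hom A i -> T}).

Let eval (w : word A) : T := \prod_(l <- w) f (tag l) (tagged l).

Let eval_eq u v : word_eq u v -> eval u = eval v.
Proof.
elim=> {u v} //.
- by move=> u v w _ -> _ ->.
- by move=> u u' v v' _ IHu _ IHv; rewrite /eval !big_cat /= -!/(eval _) IHu IHv.
- by move=> i; rewrite /eval big_seq1 big_nil gmulf1.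
- by move=> i a b; rewrite /eval !big_cons !big_nil /= !mulg1 gmulfM.
Qed.

Definition fp_lift (g : F) : T := eval (generic_quotient.repr g).

Lemma fp_liftM : {morph fp_lift : x y / x * y}.
Proof.
move=> x y; rewrite /fp_lift (eval_eq (fp_repr _)) /eval big_cat //.
Qed.

HB.instance Definition _ :=
  isGroupMorphism.Build F T fp_lift (morph_divg fp_liftM).

Lemma fp_lift_letter i (a : A i) : fp_lift (letter a) = f i a.
Proof. by rewrite /fp_lift (eval_eq (fp_repr _)) /eval big_seq1. Qed.

End FreeProductUniversal.

Section LowerCentralHom.
Local Open Scope classical_set_scope.
Variables (G H : groupType) (f : {hom G -> H}).

Lemma lower_central_hom n x : lower_central n x -> lower_central n (f x).
Proof.
case: n => // n; elim: n x => // n IH.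
pose S := [set x | lower_central n.+2 (f x)].
change (lower_central n.+2 `<=` S); apply: generated_min; last first.
  move=> _ [x [y [Gx _ ->]]]; rewrite /S /= gmulfR.
  exact/lower_centralRT/IH.
rewrite /S; split=> [|x y|x] /=; rewrite ?gmulf1 ?gmulfM ?gmulfV.
- exact: lower_central1.
- exact: lower_centralM.
- exact: lower_centralV.
Qed.

Lemma lower_central_hom_surj n : (forall y, exists x, f x = y) ->
  forall y, lower_central n y -> exists2 x, lower_central n x & f x = y.
Proof.
move=> fS; case: n => [|n].
  by move=> y _; have [x <-] := fS y; exists x.
elim: n => [|n IH].
  by move=> y _; have [x <-] := fS y; exists x.
pose S := [set y | exists2 x, lower_central n.+2 x & f x = y].
change (lower_central n.+2 `<=` S); apply: generated_min.
  split.
  - by exists 1; [exact: lower_central1|rewrite gmulf1].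
  - move=> _ _ [x Gx <-] [y Gy <-].
    by exists (x * y); [exact: lower_centralM|rewrite gmulfM].
  - by move=> _ [x Gx <-]; exists x^-1; [exact: lower_centralV|rewrite gmulfV].
move=> _ [x [y [/IH [x' Gx <-] _ ->]]]; have [y' <-] := fS y.
by exists [~ x', y']; [exact: lower_centralRT|rewrite gmulfR].
Qed.

End LowerCentralHom.

(** * Capable nilpotent products *)

Lemma lower_central2_abelian (G : groupType) (x : G) :
  (forall y z : G, commute y z) -> lower_central 2 x -> x = 1.
Proof.
move=> cG; apply: (@generated_min G _ [set 1]).
  split=> [//|_ _ -> ->|_ ->] /=; [exact: mulg1|exact: invg1].
by move=> _ [y [z [_ _ ->]]]; apply/eqP/commgP/cG.
Qed.

Section CentralQuotient.
Local Open Scope classical_set_scope.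
Variables (I : choiceType) (A : I -> groupType) (H : groupType).
Local Notation Q := (quotient_group (centerN H)).
Local Notation qmap := (quot_map (centerN H)).
Variables (theta : {hom free_product A -> Q}) (k : nat).
Hypothesis theta_surj : forall u, exists g, theta g = u.
Hypothesis theta_gamma : forall g, lower_central k.+1 g -> theta g = 1.

(** The term of index [k.+1] of the central quotient is the image of that of the free product, hence
    trivial. So the corresponding term of [H] is central. *)
Lemma lower_central_trivial : lower_central k.+2 `<=` [set (1 : H)].
Proof.
apply: generated_min.
  split=> [//|_ _ -> ->|_ ->] /=; [exact: mulg1|exact: invg1].
move=> _ [h [h' [Gh _ ->]]]; have {}Gh : lower_central k.+1 h by [].
apply/eqP/commgP.
have /(lower_central_hom_surj theta_surj) [g /theta_gamma -> /esym] :=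
  lower_central_hom (quot_map (centerN H)) Gh.
by move/quot_map_eq1; apply.
Qed.

Variables (p a : nat) (i0 : I) (x : A i0).
Hypotheses (p_prime : prime p) (k_lt_p : (k < p)%N).
Hypothesis x_gen : forall c : A i0, exists n, c = x ^+ n.
Hypothesis exp_other : forall i, i != i0 -> forall c : A i, c ^+ (p ^ a) = 1.

(** It suffices that the power of a lift [h0] of [letter x] is central. Lifts of elements of the
    factor [i0] are powers of [h0] times central elements; lifts of letters from other factors have
    central [p ^ a]-th power, so [commute_prime_power] applies to them. *)
Lemma power_letter_trivial : theta (letter x ^+ (p ^ a)) = 1.
Proof.
have [h0 th0] := quot_map_surj (theta (letter x)).
rewrite gmulfXn -th0 -gmulfXn; apply/quot_map_eq1 => h.
have [g tg] := theta_surj (qmap h).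
suff: [set g | forall h, qmap h = theta g -> commute h (h0 ^+ (p ^ a))] g.
  by move=> /(_ h (esym tg))/commute_sym.
move: {h tg} g; apply: free_product_ind; first split=> /=.
- move=> h; rewrite gmulf1 => /quot_map_eq1 Zh; exact: Zh.
- move=> g g' Cg Cg' h; have [h1 th1] := quot_map_surj (theta g).
  rewrite gmulfM => th; rewrite -(mulVKg h1 h); apply/commute_sym/commuteM.
    exact/commute_sym/Cg.
  by apply/commute_sym/Cg'; rewrite gmulfM gmulfV /= th1 th mulKg.
- move=> g Cg h; rewrite gmulfV => th; rewrite -(invgK h).
  by apply/commute_sym/commuteV/commute_sym/Cg; rewrite gmulfV /= th invgK.
move=> i c h /= th; have [ii0|ii0] := eqVneq i i0.
  move: c th; rewrite ii0 => c; have [n ->] := x_gen c.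
  rewrite gmulfXn gmulfXn -th0 -gmulfXn => /esym/quot_map_eqP Z.
  rewrite -(mulVKg (h0 ^+ n) h); apply/commute_sym/commuteM.
    exact: commuteX2.
  by apply/commute_sym; apply: Z.
apply: (commute_prime_power p_prime).
  apply: subset_trans lower_central_trivial; exact: lower_central_le.
apply/(@quot_map_eq1 _ (centerN H)).
by rewrite gmulfXn /= th -gmulfXn -gmulfXn exp_other // !gmulf1.
Qed.

End CentralQuotient.

Section LetterProjection.
Local Open Scope classical_set_scope.
Variables (I : choiceType) (A : I -> groupType) (j : I).

Let proj i (a : A i) : A j :=
  if pselect (i = j) is left e then eq_rect i A a j e else 1.

Let projM i : {morph @proj i : a b / a * b}.
Proof.
rewrite /proj => a b; case: pselect => [e|_]; last by rewrite mulg1.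
by case: _ / e.
Qed.

(** The projection of the free product onto its factor [A j], trivial on the other factors, sends
    the derived subgroup into that of an abelian group. *)
Lemma letter_lower_central2 (a : A j) : (forall b c : A j, commute b c) ->
  lower_central 2 (letter a) -> a = 1.
Proof.
move=> cA /(lower_central_hom (hom_of (fp_liftM (fun i => hom_of (@projM i))))).
move=> /(lower_central2_abelian cA) /=; rewrite /hom_of /= fp_lift_letter /=.
rewrite /proj; case: pselect => // e.
by rewrite (Prop_irrelevance e (erefl j)).
Qed.

End LetterProjection.

Lemma capable_nilpotent_product_only_if (k p r : nat) (C : 'I_r -> finGroupType)
    (x : forall i : 'I_r, C i) (alpha : 'I_r -> nat) :
    (0 < k)%N -> prime p -> (k < p)%N -> (0 < r)%N ->
    (forall (i : 'I_r) (c : C i), c \in <[x i]>) ->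
    (forall i : 'I_r, #[x i] = (p ^ alpha i)%N) ->
    (forall i : 'I_r, (1 <= alpha i)%N) ->
    (forall i j : 'I_r, (i <= j)%N -> (alpha i <= alpha j)%N) ->
  capable (nilpotent_product k (fun i : 'I_r => C i : groupType)) ->
  (1 < r)%N /\ (forall i j : 'I_r, i.+2 = r -> j.+1 = r -> alpha i = alpha j).
Proof.
move=> k_gt0 p_prime k_lt_p; case: r C x alpha => // r C x alpha _.
move=> x_gen x_order alpha_gt0 alpha_mono [H [f f_bij]].
set F := free_product (fun i : 'I_r.+1 => C i : groupType).
pose f_hom := hom_of (@gmulfM _ _ f).
pose theta := hom_of (@gmulfM _ _ (f \o quot_map (lower_centralN F k.+1))).
have theta_surj u : exists g, theta g = u.
  have [f' _ f'K] := f_bij; have [g fg] := quot_map_surj (f' u).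
  by exists g; rewrite /theta /hom_of /= fg f'K.
have f1 : f 1 = 1 by apply: (gmulf1 (s := f_hom)).
have theta1 g : theta g = 1 <-> lower_central k.+1 g.
  split=> [tg|/(quot_map_eq1 (lower_centralN F k.+1)) qg].
    by apply/(quot_map_eq1 (lower_centralN F k.+1)); apply: (bij_inj f_bij); rewrite f1.
  by rewrite /theta /hom_of /= qg f1.
have gen i (c : C i) : exists n, c = x i ^+ n.
  exact/cycleP/x_gen.
(* If [a] bounds the other exponents, the power [p ^ a] of the last generator falls into the derived
   subgroup of the free product, and projecting to its factor shows that it is trivial. *)
have alpha_max a : (forall i : 'I_r.+1, i != ord_max -> (alpha i <= a)%N) ->
    (alpha ord_max <= a)%N.
  move=> le_a; have /theta1 : theta (letter (x ord_max : (C ord_max : groupType)) ^+ (p ^ a)) = 1.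
    apply: (@power_letter_trivial _ _ _ theta k) => //.
    - by move=> g /theta1.
    - exact: gen.
    - move=> i /le_a ia c; have [n ->] := gen i c.
      have xa : x i ^+ (p ^ a) = 1.
        by apply/eqP; rewrite -order_dvdn x_order; apply: dvdn_exp2l.
      by rewrite expgnAC xa expg1n.
  move=> /(@lower_central_le _ 2 k.+1 k_gt0); rewrite -gmulfXn.
  move/letter_lower_central2 => xa; rewrite -(@dvdn_Pexp2l p) ?prime_gt1 //.
  rewrite -x_order order_dvdn; apply/eqP; apply: xa => b c.
  have [[m ->] [n ->]] := (gen _ b, gen _ c).
  exact: commuteX2.
(* The number of factors is now [r.+1]. With a single factor, even 0 bounds the empty family of
   other exponents, which contradicts [alpha_gt0]. *)
have r_gt0 : (0 < r)%N.
  rewrite lt0n; apply/negP => /eqP r0; have := alpha_max 0%N.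
  suff le0 : forall i : 'I_r.+1, i != ord_max -> (alpha i <= 0)%N.
    by move=> /(_ le0); rewrite leqNgt alpha_gt0.
  move=> i /eqP[]; apply: val_inj; have := ltn_ord i.
  by rewrite /= [X in (_ < X.+1)%N]r0 ltnS leqn0 => /eqP ->.
split=> // i j [ir] [jr].
have -> : j = ord_max by apply: val_inj.
apply/eqP; rewrite eqn_leq alpha_mono -1?ltnS //=; apply: alpha_max => l lm.
apply: alpha_mono; rewrite -ltnS ir ltn_neqAle -ltnS ltn_ord andbT.
by apply: contraNneq lm => lr; apply/eqP/val_inj.
Qed.

(** * The graded Lie ring of the lower central series *)

Section GradedCommutators.
Local Open Scope classical_set_scope.
Variable G : groupType.
Implicit Types (x y z a b g h : G) (m n : nat).
Local Notation gamma := (@lower_central G).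
Local Notation q n := (quot_map (lower_centralN G n)).

Lemma gamma_eqP n x y : q n x = q n y <-> gamma n (x^-1 * y).
Proof. exact: (quot_map_eqP (lower_centralN G n)). Qed.

Lemma gamma_eq1 n x : q n x = 1 <-> gamma n x.
Proof. exact: (quot_map_eq1 (lower_centralN G n)). Qed.

Lemma gamma_eq_mulr n x c : gamma n c -> q n (x * c) = q n x.
Proof. by move=> /gamma_eq1 qc; rewrite gmulfM /= qc mulg1. Qed.

Lemma gamma_eq_split n x y : q n x = q n y -> exists2 c, gamma n c & y = x * c.
Proof. by move=> /gamma_eqP Gc; exists (x^-1 * y); rewrite ?mulVKg. Qed.

Lemma gamma_conj n x y : gamma n x -> q n.+1 (x ^ y) = q n.+1 x.
Proof.
by move=> Gx; rewrite conjg_commg [LHS]gamma_eq_mulr //; apply: lower_centralRT.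
Qed.

Lemma gamma_commute n x y : gamma n x -> commute (q n.+1 x) (q n.+1 y).
Proof.
move=> Gx; apply/commgP/eqP; rewrite -gmulfR; apply/gamma_eq1.
exact: lower_centralRT.
Qed.

Lemma gamma_eqRl m n x x' y : gamma m y -> q n x = q n x' ->
  q (n + m) [~ x, y] = q (n + m) [~ x', y].
Proof.
move=> Gy /gamma_eq_split [c Gc ->]; rewrite commMg conjg_commg.
rewrite -mulgA [RHS]gamma_eq_mulr //; apply: lower_centralM; last exact: lower_centralR.
rewrite addnC; apply: lower_centralR => //; rewrite -invgR; apply: lower_centralV.
by apply: (lower_central_le (leqnSn m)); apply: lower_centralRT.
Qed.

Lemma gamma_eqRr m n x y y' : gamma m x -> q n y = q n y' ->
  q (m + n) [~ x, y] = q (m + n) [~ x, y'].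
Proof.
move=> Gx yy'; rewrite -(invgR y) -(invgR y') !gmulfV /= addnC.
by rewrite (gamma_eqRl Gx yy').
Qed.

(** This and the next lemmas are the bilinearity of the bracket on the graded quotients. *)
Lemma gammaMR m n a b g : gamma m a -> gamma n g ->
  q (m + n).+1 [~ a * b, g] = q (m + n).+1 [~ a, g] * q (m + n).+1 [~ b, g].
Proof.
move=> Ga Gg; rewrite commMg gmulfM /= gamma_conj //; exact: lower_centralR.
Qed.

Lemma gammaRM m n a g h : gamma m a -> gamma n g ->
  q (m + n).+1 [~ a, g * h] = q (m + n).+1 [~ a, g] * q (m + n).+1 [~ a, h].
Proof.
move=> Ga Gg; have Gag := lower_centralR Ga Gg.
by rewrite commgM gmulfM /= gamma_conj //; apply/esym/gamma_commute.
Qed.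

Lemma gammaVR m n a g : gamma m a -> gamma n g ->
  q (m + n).+1 [~ a^-1, g] = (q (m + n).+1 [~ a, g])^-1.
Proof.
move=> Ga Gg; rewrite commVg gamma_conj ?gmulfV //.
exact/lower_centralV/lower_centralR.
Qed.

Lemma gammaRV m n a g : gamma m a -> gamma n g ->
  q (m + n).+1 [~ a, g^-1] = (q (m + n).+1 [~ a, g])^-1.
Proof.
move=> Ga Gg; rewrite commgV gamma_conj ?gmulfV //.
exact/lower_centralV/lower_centralR.
Qed.

Lemma gammaXR m n a g l : gamma m a -> gamma n g ->
  q (m + n).+1 [~ a ^+ l, g] = q (m + n).+1 [~ a, g] ^+ l.
Proof.
move=> Ga Gg; elim: l => [|l IH]; first by rewrite !expg0 comm1g gmulf1.
by rewrite !expgS (gammaMR _ Ga Gg) IH.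
Qed.

(** The Jacobi identity: the Hall-Witt identity read in degree [m + n + 1], where conjugations
    disappear and inverses come out of commutators. *)
Lemma gamma_jacobi m n a g x : gamma m a -> gamma n g ->
  q (m + n).+2 [~ a, [~ g, x]] =
  q (m + n).+2 [~ [~ a, g], x] * (q (m + n).+2 [~ [~ a, x], g])^-1.
Proof.
move=> Ga Gg.
have GV l y : gamma l y -> gamma l y^-1 by apply: lower_centralV.
have Gx : gamma 1 x by [].
(* [E1], [E2] and [E3] identify the three factors of the Hall-Witt identity for [g], [x^-1], [a]. *)
have E1 : q (m + n).+2 ([~ [~ g, x], a] ^ x^-1) = (q (m + n).+2 [~ a, [~ g, x]])^-1.
  rewrite -gmulfV invgR gamma_conj // -addnS.
  by rewrite -(invgR a); apply: GV; apply: lower_centralR => //; apply: lower_centralRT.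
have Gax : gamma m.+1 [~ a, x] by apply: lower_centralRT.
have Gag : gamma (m + n) [~ a, g] by apply: lower_centralR.
have Gxa : gamma m.+1 [~ x^-1, a^-1].
  by rewrite -[[~ x^-1, a^-1]]invgR; apply: (GV); apply: lower_centralRT; apply: GV.
have Gag' : gamma (m + n) [~ a, g^-1] by apply: lower_centralR => //; apply: GV.
have Exa : q m.+2 [~ x^-1, a^-1] = q m.+2 [~ a, x]^-1.
  have -> := @gammaRV 1 m x^-1 a (GV 1%N _ Gx) Ga.
  by have -> := @gammaVR 1 m x a Gx Ga; rewrite invgK invgR.
have E2 : q (m + n).+2 ([~ [~ x^-1, a^-1], g] ^ a) = (q (m + n).+2 [~ [~ a, x], g])^-1.
  rewrite (gamma_conj _ (lower_centralR Gxa Gg)).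
  have <- := @gammaVR m.+1 n _ _ Gax Gg.
  exact: (@gamma_eqRl n m.+2 _ _ _ Gg Exa).
have E3 : q (m + n).+2 ([~ [~ a, g^-1], x^-1] ^ g) = q (m + n).+2 [~ [~ a, g], x].
  rewrite (gamma_conj _ (lower_centralRT _ Gag')).
  have := gammaRV Gag' Gx; have := gammaVR Gag' Gx; rewrite addn1 => E ->; rewrite -E.
  rewrite -[(m + n).+2]addn1; apply: gamma_eqRl => //.
  by rewrite gmulfV /= (gammaRV Ga Gg) invgK.
have : (q (m + n).+2 [~ a, [~ g, x]])^-1 * (q (m + n).+2 [~ [~ a, x], g])^-1 *
    q (m + n).+2 [~ [~ a, g], x] = 1.
  rewrite -E1 -E2 -E3 -!gmulfM -[RHS](gmulf1 (s := q (m + n).+2)); congr (q _ _).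
  by rewrite -{1}[x]invgK Hall_Witt.
rewrite -mulgA => /(canRL (mulKg _)); rewrite mulg1 invgK => <-.
rewrite -gmulfV; apply: gamma_commute.
rewrite -addSn; apply: lower_centralV; exact: lower_centralR.
Qed.

End GradedCommutators.

(** * Noncommutative integer polynomials as signed words *)

Section SignedWords.
Local Open Scope classical_set_scope.
Variable I : eqType.

(** A noncommutative polynomial with integer coefficients, as a list of monomials in which [true]
    marks a minus sign. The list order allows evaluation as a product in a nonabelian group. *)
Definition sword := seq (bool * seq I).
Definition neg (s : sword) : sword := [seq (~~ t.1, t.2) | t <- s].
Definition rmul (s : sword) i : sword := [seq (t.1, rcons t.2 i) | t <- s].
Definition lmul i (s : sword) : sword := [seq (t.1, i :: t.2) | t <- s].
(** The Lie bracket of [s] with the variable [X_i]. *)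
Definition bracket (s : sword) i : sword := rmul s i ++ neg (lmul i s).
Definition homog n (s : sword) := all (fun t => size t.2 == n) s.

Lemma homog_cat n s s' : homog n (s ++ s') = homog n s && homog n s'.
Proof. exact: all_cat. Qed.

Lemma homog_neg n s : homog n (neg s) = homog n s.
Proof. by rewrite /homog all_map; apply: eq_all. Qed.

Lemma homog_bracket n s i : homog n s -> homog n.+1 (bracket s i).
Proof.
move=> /allP ns; rewrite homog_cat homog_neg /homog !all_map.
by apply/andP; split; apply/allP => t /ns /eqP /=; rewrite ?size_rcons => ->.
Qed.

Variable G : groupType.
Implicit Types (x y z a b g h : G) (m n : nat) (s : sword) (w v : seq I).
Local Notation gamma := (@lower_central G).
Local Notation q n := (quot_map (lower_centralN G n)).

Definition evalw (f : seq I -> G) s : G :=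
  \prod_(t <- s) (if t.1 then (f t.2)^-1 else f t.2).

Lemma evalw_cat f s s' : evalw f (s ++ s') = evalw f s * evalw f s'.
Proof. by rewrite /evalw big_cat. Qed.

Lemma evalw_cons f t s :
  evalw f (t :: s) = (if t.1 then (f t.2)^-1 else f t.2) * evalw f s.
Proof. by rewrite /evalw big_cons. Qed.

Lemma evalw_nil f : evalw f [::] = 1.
Proof. by rewrite /evalw big_nil. Qed.

Lemma evalw_rmul f s i : evalw f (rmul s i) = evalw (fun w => f (rcons w i)) s.
Proof. by rewrite /evalw big_map. Qed.

Lemma evalw_lmul f s i : evalw f (lmul i s) = evalw (fun w => f (i :: w)) s.
Proof. by rewrite /evalw big_map. Qed.

Lemma eq_evalw f f' n s : homog n s -> (forall w, size w = n -> f w = f' w) ->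
  evalw f s = evalw f' s.
Proof.
move=> /allP ns ff'; apply: eq_big_seq => t /ns/eqP/ff' E.
by rewrite E.
Qed.

Section Graded.
Variables (f : seq I -> G) (n N : nat).
Hypothesis fN : forall w, size w = n -> gamma N (f w).

Let term_gamma (t : bool * seq I) : size t.2 == n ->
  gamma N (if t.1 then (f t.2)^-1 else f t.2).
Proof. by move=> /eqP/fN Gf; case: t.1 => //; apply: lower_centralV. Qed.

Lemma evalw_neg s : homog n s ->
  q N.+1 (evalw f (neg s)) = (q N.+1 (evalw f s))^-1.
Proof.
elim: s => [|[b w] s IH]; first by rewrite /= evalw_nil gmulf1 invg1.
move=> /= /andP [/eqP/fN Gw ns]; rewrite !evalw_cons !gmulfM /= {}IH //.
have Cw := gamma_commute (evalw f s) Gw.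
case: b; rewrite /= gmulfV invgM /= ?invgK; first exact: commuteV.
by rewrite -!invgM Cw.
Qed.

Lemma evalw_commg s y : homog n s ->
  q N.+2 [~ evalw f s, y] = q N.+2 (evalw (fun w => [~ f w, y]) s).
Proof.
have Gy : gamma 1 y by [].
elim: s => [|[b w] s IH]; first by rewrite !evalw_nil comm1g.
move=> /= /andP [nw ns]; have Gt := @term_gamma (b, w) nw.
rewrite !evalw_cons [RHS]gmulfM.
have := gammaMR (evalw f s) Gt Gy; rewrite addn1 => ->; rewrite IH //.
congr (_ * _); case: b Gt => //= _; rewrite gmulfV.
by have := gammaVR (fN (eqP nw)) Gy; rewrite addn1.
Qed.

Lemma evalw_filter (P : pred (seq I)) s : homog n s ->
  q N.+1 (evalw f s) = q N.+1 (evalw f [seq t <- s | P t.2]) *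
                       q N.+1 (evalw f [seq t <- s | ~~ P t.2]).
Proof.
elim: s => [|t s IH]; first by rewrite /= evalw_nil gmulf1 mulg1.
move=> /= /andP [nt ns]; case: (P t.2); rewrite !evalw_cons !gmulfM /= IH //.
  exact: mulgA.
by rewrite !mulgA (gamma_commute _ (term_gamma nt)).
Qed.

Lemma evalw_filter_pred1 v s : size v = n ->
  q N.+1 (evalw f [seq t <- s | t.2 == v]) =
  q N.+1 (f v) ^+ count_mem (false, v) s * (q N.+1 (f v))^-1 ^+ count_mem (true, v) s.
Proof.
move=> nv; elim: s => [|[b w] s IH]; first by rewrite /= evalw_nil gmulf1 mulg1.
rewrite /= !xpair_eqE; case: (eqVneq w v) => [->|_]; rewrite ?andbF ?add0n //.
rewrite evalw_cons gmulfM /= {}IH; case: b => /=; rewrite add0n add1n expgS ?mulgA //.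
rewrite gmulfV; congr (_ * _).
by apply/commuteX/commute_sym/commuteV.
Qed.

(** Modulo [gamma N.+1] the factors commute, so only the coefficient of each word counts, modulo an
    exponent [d] killing its value. The induction removes all occurrences of the first word at
    once. *)
Lemma evalw_gamma_eq1 s : homog n s ->
  (forall v, size v = n -> exists2 d, gamma N.+1 (f v ^+ d) &
     count_mem (false, v) s = count_mem (true, v) s %[mod d]) ->
  gamma N.+1 (evalw f s).
Proof.
have [e] := ubnP (size s); elim: e s => // e IH [|[b v] s] se ns cnt.
  by rewrite evalw_nil; apply: lower_central1.
apply/gamma_eq1; rewrite (evalw_filter (pred1 v)) //.
have nv : size v = n by move: ns => /= /andP [/eqP].
set s0 := _ :: _ in ns cnt *.
have -> : q N.+1 (evalw f [seq t <- s0 | t.2 == v]) = 1.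
  rewrite evalw_filter_pred1 //; have [d /gamma_eq1 fd] := cnt v nv.
  rewrite gmulfXn in fd; set u := q _ _ in fd *.
  have um c : u ^+ c = u ^+ (c %% d).
    by rewrite {1}(divn_eq c d) expgnDr mulnC expgnA fd expg1n mul1g.
  by rewrite expVgn [u ^+ _]um [u ^+ count_mem _ _]um => ->; rewrite mulgV.
rewrite mul1g; apply/gamma_eq1/IH.
- move: se; rewrite /s0 /= eqxx /= ltnS; apply: leq_ltn_trans.
  by rewrite size_filter count_size.
- by apply/allP => t; rewrite mem_filter => /andP [_ /(allP ns)].
- move=> w nw; have [d fd cd] := cnt w nw; exists d => //.
  rewrite !count_filter.
  have [->|wv] := eqVneq w v.
    have c0 c : count (predI (pred1 (c, v)) (fun t => ~~ pred1 v t.2)) s0 = 0%N.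
      apply/eqP; rewrite -leqn0 leqNgt -has_count; apply/hasPn => -[c' y] _ /=.
      by rewrite xpair_eqE; case: (y == v); rewrite ?andbF.
    by rewrite !c0.
  rewrite (@eq_count _ _ (pred1 (false, w))) => [|[c y] /=]; last first.
    by rewrite xpair_eqE; case: (eqVneq y w) => [->|]; rewrite ?andbF // wv andbT.
  rewrite cd; congr (_ %% _)%N; apply: eq_count => -[c y] /=.
  by rewrite xpair_eqE; case: (eqVneq y w) => [->|]; rewrite ?andbF // wv !andbT.
Qed.

End Graded.
End SignedWords.

(** * Left-normed commutators and the Dynkin map *)

Section Dynkin.
Local Open Scope classical_set_scope.
Variables (I : eqType) (G : groupType) (x : I -> G).
Implicit Types (y z a b g h : G) (m n : nat) (s : sword I) (w v : seq I).
Local Notation gamma := (@lower_central G).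
Local Notation q n := (quot_map (lower_centralN G n)).

Definition lcomm a w : G := foldl (fun b i => [~ b, x i]) a w.
(** The Dynkin map on monomials, with values in the group. *)
Definition lnorm w : G := if w is i :: w' then lcomm (x i) w' else 1.

Lemma lcomm_rcons a w i : lcomm a (rcons w i) = [~ lcomm a w, x i].
Proof. exact: foldl_rcons. Qed.

Lemma lnorm_rcons w i : (0 < size w)%N -> lnorm (rcons w i) = [~ lnorm w, x i].
Proof. by case: w => // j w _; apply: lcomm_rcons. Qed.

Lemma lcomm_gamma m a w : gamma m a -> gamma (m + size w) (lcomm a w).
Proof.
elim: w m a => [|i w IH] m a Ga; first by rewrite addn0.
by rewrite /= -addSnnS; apply: IH; apply: lower_centralRT.
Qed.

Lemma lnorm_gamma w : gamma (size w) (lnorm w).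
Proof. by case: w => // i w; apply: (@lcomm_gamma 1). Qed.

(* s is the image of g in the degree n part of the free Lie ring: it acts like
   bracketing with g, and the Dynkin map takes it to n times g. *)
Definition Lie_symbol n s g :=
  [/\ homog n s,
      forall m a, gamma m a ->
        q (m + n).+1 (evalw (lcomm a) s) = q (m + n).+1 [~ a, g] &
      q n.+1 (evalw lnorm s) = q n.+1 (g ^+ n)].

Let lcommN m n a : gamma m a -> forall w, size w = n -> gamma (m + n) (lcomm a w).
Proof. by move=> Ga w <-; apply: lcomm_gamma. Qed.

Let lnormN n w : size w = n -> gamma n (lnorm w).
Proof. by move=> <-; apply: lnorm_gamma. Qed.

Lemma Lie_symbol_gen i : Lie_symbol 1 [:: (false, [:: i])] (x i).
Proof.
by split=> // [m a _|]; rewrite evalw_cons evalw_nil mulg1 ?expg1.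
Qed.

Lemma Lie_symbol1 n : Lie_symbol n [::] 1.
Proof.
split=> // [m a _|]; first by rewrite evalw_nil commg1.
by rewrite evalw_nil expg1n.
Qed.

Lemma Lie_symbolM n s s' g g' : gamma n g -> gamma n g' ->
  Lie_symbol n s g -> Lie_symbol n s' g' -> Lie_symbol n (s ++ s') (g * g').
Proof.
move=> Gg Gg' [hs As Ds] [hs' As' Ds']; split=> [|m a Ga|].
- by rewrite homog_cat hs.
- by rewrite evalw_cat gmulfM /= As // As' // (gammaRM _ Ga Gg).
- rewrite evalw_cat gmulfM /= Ds Ds' !gmulfXn gmulfM /= expgMn //.
  exact: gamma_commute.
Qed.

Lemma Lie_symbolV n s g : gamma n g -> Lie_symbol n s g ->
  Lie_symbol n (neg s) g^-1.
Proof.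
move=> Gg [hs As Ds]; split=> [|m a Ga|].
- by rewrite homog_neg.
- by rewrite (evalw_neg (@lcommN _ n _ Ga)) // As // (gammaRV Ga Gg).
- by rewrite (evalw_neg (@lnormN n)) // Ds expVgn gmulfV.
Qed.

Lemma Lie_symbolJ n s g y : gamma n g -> Lie_symbol n s g ->
  Lie_symbol n s (g ^ y).
Proof.
move=> Gg [hs As Ds]; split=> // [m a Ga|].
  rewrite As // -addnS; apply: gamma_eqRr => //.
  by rewrite gamma_conj.
by rewrite Ds !gmulfXn /= gamma_conj.
Qed.

(** For the action this is [gamma_jacobi]. For the Dynkin map, [s X_i] gives [n] times [[~ g, x i]],
    while [X_i s] gives [[~ x i, g]] by the action of [s] on [x i]; the difference is [n.+1] times
    [[~ g, x i]]. *)
Lemma Lie_symbol_bracket n s g i : (0 < n)%N -> gamma n g ->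
  Lie_symbol n s g -> Lie_symbol n.+1 (bracket s i) [~ g, x i].
Proof.
move=> n0 Gg [hs As Ds]; have Gx : gamma 1 (x i) by [].
have hl : homog n.+1 (lmul i s).
  by apply/allP => _ /mapP [t /(allP hs) /= /eqP nt ->]; rewrite /= nt.
split=> [|m a Ga|]; first exact: homog_bracket.
- rewrite addnS evalw_cat gmulfM /= evalw_rmul.
  rewrite -addnS (evalw_neg (@lcommN _ n.+1 _ Ga)) // addnS evalw_lmul.
  rewrite (eq_evalw hs (f' := fun w => [~ lcomm a w, x i])); last first.
    by move=> w _; apply: lcomm_rcons.
  rewrite -(evalw_commg (@lcommN _ n _ Ga)) // (gamma_jacobi _ Ga Gg).
  have Gax : gamma m.+1 [~ a, x i] by apply: lower_centralRT.
  have := As _ _ Gax; rewrite addSn => <-; congr (_ * _).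
  by rewrite -[(m + n).+2]addn1; apply: gamma_eqRl => //; apply: As.
- rewrite evalw_cat gmulfM /= evalw_rmul (evalw_neg (@lnormN n.+1)) //.
  rewrite evalw_lmul (eq_evalw hs (f' := fun w => [~ lnorm w, x i])); last first.
    by move=> w nw; apply: lnorm_rcons; rewrite nw.
  rewrite -(evalw_commg (@lnormN n)) //.
  have := As 1%N _ Gx; rewrite add1n /= => ->.
  rewrite -gmulfV invgR expgSr [RHS]gmulfM; congr (_ * _) => /=.
  have := gammaXR n Gg Gx; rewrite gmulfXn addn1 => <-.
  by rewrite -[n.+2]addn1; apply: gamma_eqRl.
Qed.

End Dynkin.

(** * Unitriangular matrices *)

Section Filtration.
Local Open Scope ring_scope.
Variables (R : finComUnitRingType) (k : nat).
Local Notation M := 'M[R]_k.+2.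
Local Notation U := {unit M}.
Implicit Types (A B : M) (g h y : U) (n m : nat).

(** The filtration by superdiagonals. Size [k.+2] leaves room for words of length up to [k.+1]. *)
Definition upper n A := forall i j : 'I_k.+2, (j < i + n)%N -> A i j = 0.

Lemma upper0 n : upper n 0. Proof. by move=> i j _; rewrite mxE. Qed.

Lemma upperD n A B : upper n A -> upper n B -> upper n (A + B).
Proof. by move=> uA uB i j ij; rewrite mxE uA // uB // addr0. Qed.

Lemma upperN n A : upper n A -> upper n (- A).
Proof. by move=> uA i j ij; rewrite mxE uA // oppr0. Qed.

Lemma upperZ n c A : upper n A -> upper n (c *: A).
Proof. by move=> uA i j ij; rewrite mxE uA // mulr0. Qed.

Lemma upper_le n m A : (n <= m)%N -> upper m A -> upper n A.
Proof.
by move=> nm uA i j ij; apply: uA; apply: leq_trans ij _; rewrite leq_add2l.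
Qed.

Lemma upperM n m A B : upper n A -> upper m B -> upper (n + m) (A * B).
Proof.
move=> uA uB i j ij; rewrite -mulmxE mxE big1 // => l _.
have [li|il] := ltnP l (i + n); first by rewrite uA ?mul0r.
rewrite [B l j]uB ?mulr0 //; apply: leq_trans ij _.
by rewrite addnA leq_add2r.
Qed.

Lemma upperM_diag n m A B (i l j : 'I_k.+2) : upper n A -> upper m B ->
  l = (i + n)%N :> nat -> j = (l + m)%N :> nat -> (A * B) i j = A i l * B l j.
Proof.
move=> uA uB il lj; rewrite -mulmxE mxE (bigD1 l) //= big1 ?addr0 // => l' ll'.
have [li|il'] := ltnP l' (i + n); first by rewrite uA ?mul0r.
rewrite [B l' j]uB ?mulr0 // lj ltn_add2r ltn_neqAle il il' andbT -il.
by apply: contraNneq ll' => /val_inj ->.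
Qed.

Lemma upper_eq0 A : upper k.+2 A -> A = 0.
Proof.
move=> uA; apply/matrixP => i j; rewrite mxE uA //.
exact: leq_trans (ltn_ord j) (leq_addl _ _).
Qed.

(** The leading term of [g]: the entries of its [n]-th superdiagonal, indexed by row. Rows are
    natural numbers so that the shifts in [lead_comm] carry no bounds. *)
Definition lead n (c : nat -> R) g :=
  upper n (val g - 1) /\
  forall i j : 'I_k.+2, j = (i + n)%N :> nat -> val g i j = c i.

Lemma upper1_unit A : upper 1 (A - 1) -> A \is a GRing.unit.
Proof.
move=> uA; have A1 (i j : 'I_k.+2) : (j <= i)%N -> A i j = (i == j)%:R.
  by move=> ji; have := uA i j; rewrite addn1 ltnS !mxE => /(_ ji)/eqP;
     rewrite subr_eq0 => /eqP.
rewrite -[_ \is a _]/(A \in unitmx) unitmxE -det_tr det_trig.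
  by rewrite big1 ?unitr1 // => i _; rewrite mxE A1 // eqxx.
apply/is_trig_mxP => i j ij; rewrite mxE A1 ?(ltnW ij) //.
by rewrite -val_eqE /= gtn_eqF.
Qed.

Let uminus g : M := val g - 1.

Let val_uminus g : val g = 1 + uminus g. Proof. by rewrite addrC subrK. Qed.

Let uminusM g h :
  uminus (g * h)%g = uminus g + uminus h + uminus g * uminus h.
Proof.
rewrite {1}/uminus FinRing.val_unitM !val_uminus mulrDl mul1r mulrDr mulr1.
by rewrite -[1 + _ + _]addrA [1 + _]addrC addrK addrCA addrA.
Qed.

Lemma upper_unitM n g h : upper n (val g - 1) -> upper n (val h - 1) ->
  upper n (val (g * h)%g - 1).
Proof.
move=> ug uh; rewrite [_ - _]uminusM; apply: upperD; first exact: upperD.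
exact: upper_le (leq_addr n n) (upperM ug uh).
Qed.

Lemma upper_unit1 n : upper n (val (1 : U)%g - 1).
Proof. by rewrite FinRing.val_unit1 subrr; apply: upper0. Qed.

(** The unit group is finite, so the inverse is a power. *)
Lemma upper_unitV n g : upper n (val g - 1) -> upper n (val g^-1%g - 1).
Proof.
move=> ug; rewrite (mulg1_eq (x := g) (y := (g ^+ #[g].-1)%g)); last first.
  by rewrite -expgS prednK ?order_gt0 // expg_order.
elim: _.-1 => [|l IH]; first exact: upper_unit1.
by rewrite expgS; apply: upper_unitM.
Qed.

Lemma lead_uminus n c g : (0 < n)%N -> lead n c g <->
  upper n (uminus g) /\
  forall i j : 'I_k.+2, j = (i + n)%N :> nat -> uminus g i j = c i.
Proof.
move=> n0; have E (i j : 'I_k.+2) : j = (i + n)%N :> nat -> uminus g i j = val g i j.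
  move=> ij; rewrite !mxE -val_eqE /= ij -{1}[val i]addn0 eqn_add2l.
  by rewrite eq_sym (gtn_eqF n0) subr0.
by split=> -[ug lg]; split=> // i j ij; [rewrite E|rewrite -E] => //; apply: lg.
Qed.

Lemma lead1 n : (0 < n)%N -> lead n (fun=> 0) 1%g.
Proof.
move=> n0; apply/lead_uminus => //; rewrite /uminus FinRing.val_unit1 subrr.
by split=> [|i j _]; [exact: upper0|rewrite mxE].
Qed.

Lemma leadM n c d g h : (0 < n)%N -> lead n c g -> lead n d h ->
  lead n (fun i => c i + d i) (g * h)%g.
Proof.
move=> n0 /(lead_uminus _ _ n0) [ug lg] /(lead_uminus _ _ n0) [uh lh].
apply/lead_uminus => //; split; first exact: upper_unitM.
move=> i j ij; rewrite uminusM mxE [X in X + _]mxE lg // lh //.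
rewrite (upperM ug uh) ?addr0 // ij addnA -[X in (X < _)%N]addn0.
by rewrite ltn_add2l.
Qed.

Lemma leadV n c g : (0 < n)%N -> lead n c g -> lead n (fun i => - c i) g^-1%g.
Proof.
move=> n0 /(lead_uminus _ _ n0) [ug lg]; have ugV := upper_unitV ug.
apply/lead_uminus => //; split=> // i j ij; rewrite -(lg i j ij).
have := uminusM g g^-1%g; rewrite mulgV {1}/uminus FinRing.val_unit1 subrr.
move=> /matrixP/(_ i j)/esym; rewrite mxE [X in X + _]mxE [RHS]mxE.
rewrite (upperM ug ugV) ?addr0 => [/eqP|]; first by rewrite addrC addr_eq0 => /eqP.
by rewrite ij addnA -[X in (X < _)%N]addn0 ltn_add2l.
Qed.

Lemma lead_upper n g : upper n.+1 (val g - 1) -> (0 < n)%N -> lead n (fun=> 0) g.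
Proof.
move=> ug n0; apply/lead_uminus => //; split; first exact: upper_le ug.
by move=> i j ij; rewrite ug // ij addnS.
Qed.

Lemma eq_lead n c d g : (forall i, (i + n < k.+2)%N -> c i = d i) ->
  lead n c g -> lead n d g.
Proof.
move=> cd [ug lg]; split=> // i j ij; rewrite -cd ?lg //.
by rewrite -ij.
Qed.

(* With g = 1 + a, y = 1 + b and c = [g, y] - 1, gy = yg(1 + c) reads
   ab - ba = yg c, and yg is 1 up to the first superdiagonal. *)
Lemma lead_comm n c d g y : (0 < n)%N -> lead n c g -> lead 1 d y ->
  lead n.+1 (fun i => c i * d (i + n)%N - d i * c i.+1) [~ g, y]%g.
Proof.
move=> n0 /(lead_uminus _ _ n0) [ug lg] /(lead_uminus _ _ (ltn0Sn 0)) [uy ly].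
set a := uminus g in ug lg *; set b := uminus y in uy ly *.
have uab : upper n.+1 (a * b - b * a).
  apply: upperD; first by rewrite -addn1; apply: upperM.
  by apply: upperN; rewrite -add1n; apply: upperM.
have Ec : uminus [~ g, y]%g = (1 + uminus (y * g)^-1%g) * (a * b - b * a).
  rewrite -val_uminus; have -> : [~ g, y]%g = ((y * g)^-1 * (g * y))%g.
    by rewrite /commg /conjg invMg !mulgA.
  rewrite /uminus FinRing.val_unitM.
  have -> : 1 = val (y * g)^-1%g * val (y * g)%g.
    by rewrite -FinRing.val_unitM mulVg FinRing.val_unit1.
  rewrite -mulrBr !FinRing.val_unitM; congr (_ * _).
  rewrite (val_uminus g) mulrDl mul1r mulrDr mulr1 opprD addrACA subrr add0r.
  by rewrite (val_uminus y) mulrDr mulr1 [(1 + _) * _]mulrDl mul1r opprD addrACA subrr add0r.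
have uV : upper 1 (uminus (y * g)^-1%g).
  by apply/upper_unitV/upper_unitM => //; apply: upper_le ug.
have uc : upper n.+2 (uminus (y * g)^-1%g * (a * b - b * a)).
  by rewrite -add1n; apply: upperM.
apply/lead_uminus => //; rewrite Ec mulrDl mul1r; split.
  by apply: upperD => //; apply: upper_le uc.
move=> i j ij; rewrite mxE [X in _ + X]uc ?ij ?addr0 //; last by rewrite ltn_add2l.
have [jk ik] := (ltn_ord j, ltn_ord i); rewrite ij addnS in jk.
have l1k : (i + n < k.+2)%N by apply: ltnW.
have l2k : (i.+1 < k.+2)%N by apply: leq_ltn_trans jk; rewrite ltnS leq_addr.
rewrite mxE [X in _ + X]mxE.
rewrite (upperM_diag (l := Ordinal l1k) ug uy) //=; last by rewrite addn1 -addnS.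
rewrite (upperM_diag (l := Ordinal l2k) uy ug) //= ?addn1 // ?ij ?addnS //.
by rewrite lg // ly ?addn1 -?addnS // ly ?addn1 // lg //= ij addSnnS.
Qed.

Lemma leadJ n c d g y : (0 < n)%N -> lead n c g -> lead 1 d y ->
  lead n c (g ^ y)%g.
Proof.
move=> n0 lg ly; have [uR _] := lead_comm n0 lg ly.
have -> : (g ^ y = g * [~ g, y])%g by rewrite commgEl mulKVg.
have := leadM n0 lg (lead_upper uR n0); apply: eq_lead => i _; exact: addr0.
Qed.

(** With [g = 1 + a] and [y = 1 + b], the products [a * b] and [b * a] lie in degree [k.+2], hence
    vanish. *)
Lemma upper_commute g y : upper k.+1 (val g - 1) -> upper 1 (val y - 1) ->
  commute g y.
Proof.
move=> ug uy; have Z (a b : M) : upper k.+1 a -> upper 1 b -> a * b = 0 /\ b * a = 0.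
  move=> ua ub; split; apply: upper_eq0; first by have := upperM ua ub; rewrite addn1.
  by have := upperM ub ua; rewrite add1n.
apply: val_inj; rewrite !FinRing.val_unitM !val_uminus.
have [ab ba] := Z _ _ ug uy.
by rewrite mulrDl mul1r mulrDr mulr1 ab addr0 mulrDl mul1r mulrDr mulr1 ba addr0 addrAC.
Qed.

End Filtration.

(** * Truncated exponentials of nilpotent matrices *)

Section TruncatedExponential.
Local Open Scope ring_scope.
Variables (R : finComUnitRingType) (k : nat).
Hypothesis k_gt0 : (0 < k)%N.
Hypothesis fact_unit : forall j, (j <= k)%N -> (j`!)%:R \is a @GRing.unit R.

Definition texp : {poly R} := \poly_(j < k.+1) (j`!%:R)^-1.

Let bin_div_fact d j : (j <= d)%N -> (d <= k)%N ->
  'C(d, j)%:R / d`!%:R = (j`!%:R)^-1 / (d - j)`!%:R :> R.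
Proof.
move=> jd dk; have := fact_unit dk; rewrite -(bin_fact jd) natrM.
have uJ := fact_unit (leq_trans jd dk).
have uD := fact_unit (leq_trans (leq_subr j d) dk).
rewrite unitrM => /andP [uC uJD]; rewrite invrM // mulrC mulrVK // natrM.
by rewrite invrM // mulrC.
Qed.

(** Up to degree [k], the [m]-th power of exp(X) is exp(mX); the induction step is the binomial
    expansion of [(m + 1) ^ d]. *)
Lemma coef_texpX m d : (d <= k)%N -> (texp ^+ m)`_d = m%:R ^+ d / d`!%:R.
Proof.
elim: m d => [|m IH] d dk.
  rewrite expr0 coef1; case: d dk => [|d] _; first by rewrite expr0 divr1.
  by rewrite expr0n mul0r.
rewrite exprS coefM -natr1 exprDn mulr_suml; apply: eq_bigr => -[j jd] _ /=.
have jk : (j <= k)%N by apply: leq_trans dk.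
have djk : (d - j <= k)%N by apply: leq_trans dk; apply: leq_subr.
rewrite IH // coef_poly ltnS jk expr1n mulr1 -[_ ^+ _ *+ _]mulr_natr -[RHS]mulrA bin_div_fact //.
by rewrite mulrCA.
Qed.

Variable X : 'M[R]_k.+2.
Hypothesis uX : upper 1 X.

Let upperX d : upper d (X ^+ d).
Proof.
elim: d => [|d IH]; last by rewrite exprS -[d.+1]add1n; apply: upperM.
move=> i j; rewrite addn0 expr0 mxE -val_eqE /= => ji.
by rewrite gtn_eqF.
Qed.

Lemma upper_horner_mx n (p : {poly R}) : (forall d, (d < n)%N -> p`_d = 0) ->
  upper n (horner_mx X p).
Proof.
move=> p0; rewrite -[p]coefK poly_def rmorph_sum /=.
elim/big_rec: _ => [|i A _ uA]; first exact: upper0.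
apply: upperD => //; rewrite linearZ /= rmorphXn /= horner_mx_X.
have [ni|/p0 ->] := leqP n i; last by rewrite scale0r; apply: upper0.
by apply/upperZ/(upper_le ni).
Qed.

Definition mx_texp : 'M[R]_k.+2 := horner_mx X texp.

Let coef_texp d : (d <= k)%N -> texp`_d = (d`!%:R)^-1.
Proof. by move=> dk; rewrite -[texp]expr1 coef_texpX // expr1n mul1r. Qed.

Lemma upper_texp1 : upper 1 (mx_texp - 1).
Proof.
rewrite -(rmorph1 (horner_mx X)) -rmorphB; apply: upper_horner_mx => -[] // _.
by rewrite coefB coef1 coef_texp // invr1 subrr.
Qed.

Lemma upper_texp2 : upper 2 (mx_texp - 1 - X).
Proof.
have -> : mx_texp - 1 - X = horner_mx X (texp - 1 - 'X).
  by rewrite !rmorphB rmorph1 /= horner_mx_X.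
apply: upper_horner_mx => -[|[]] // _;
  by rewrite !coefB coef1 coefX coef_texp //= invr1 ?subr0 subrr.
Qed.

(** When [m] vanishes in [R], so do the coefficients [m ^ d / d!] of degrees 1 to [k]. *)
Lemma upper_texp_expn m : m%:R = 0 :> R -> upper k.+1 (mx_texp ^+ m - 1).
Proof.
move=> m0; rewrite -(rmorph1 (horner_mx X)) -rmorphXn -rmorphB.
apply: upper_horner_mx => d; rewrite ltnS => dk.
rewrite coefB coef_texpX // m0 coef1; case: d dk => [|d] _.
  by rewrite expr0 divr1 subrr.
by rewrite expr0n mul0r subrr.
Qed.

Definition unit_texp : {unit 'M[R]_k.+2} :=
  FinRing.unit _ (upper1_unit upper_texp1).

Lemma lead_texp (c : nat -> R) :
  (forall i j : 'I_k.+2, j = i.+1 :> nat -> X i j = c i) ->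
  lead 1 c unit_texp.
Proof.
move=> Xc; split=> [|i j ij]; first exact: upper_texp1.
have := upper_texp2 (i := i) (j := j); rewrite !mxE -val_eqE /= ij addn1 addn2.
rewrite (ltn_eqF (ltnSn _)) subr0 => /(_ (ltnSn _))/eqP.
by rewrite subr_eq0 => /eqP ->; rewrite Xc // ij addn1.
Qed.

Lemma upper_unit_texpX m : m%:R = 0 :> R ->
  upper k.+1 (val (unit_texp ^+ m)%g - 1).
Proof. by move=> m0; rewrite FinRing.val_unitX; apply: upper_texp_expn. Qed.

End TruncatedExponential.

(** * Coefficients of signed words and path representations *)

Section SignedWordCoefficients.
Local Open Scope ring_scope.
Variables (R : comNzRingType) (I : eqType) (keep : pred I).
Implicit Types (s : sword I) (w : seq I).

Definition wcoef s w : R := \sum_(t <- s | t.2 == w) (-1) ^+ t.1.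

Lemma wcoef_cat s s' w : wcoef (s ++ s') w = wcoef s w + wcoef s' w.
Proof. by rewrite /wcoef big_cat. Qed.

Lemma wcoef_neg s w : wcoef (neg s) w = - wcoef s w.
Proof.
rewrite /wcoef big_map -sumrN; apply: eq_bigr => -[b u] _ /=.
by rewrite signrN.
Qed.

Lemma wcoef_rmul s i w j : wcoef (rmul s i) (rcons w j) = (j == i)%:R * wcoef s w.
Proof.
rewrite /wcoef big_map /=; case: eqVneq => [->|ji].
  by rewrite mul1r; apply: eq_bigl => t; rewrite eqseq_rcons eqxx andbT.
rewrite mul0r big1_seq // => t /andP []; rewrite eqseq_rcons eq_sym.
by rewrite [i == j]eq_sym (negPf ji) andbF.
Qed.

Lemma wcoef_lmul s i w j : wcoef (lmul i s) (j :: w) = (j == i)%:R * wcoef s w.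
Proof.
rewrite /wcoef big_map /=; case: eqVneq => [->|ji].
  by rewrite mul1r; apply: eq_bigl => t; rewrite eqseq_cons eqxx.
rewrite mul0r big1_seq // => t /andP []; rewrite eqseq_cons.
by rewrite [i == j]eq_sym (negPf ji).
Qed.

Lemma wcoef_count s w :
  wcoef s w = (count_mem (false, w) s)%:R - (count_mem (true, w) s)%:R.
Proof.
elim: s => [|[b u] s IH]; first by rewrite /wcoef big_nil subrr.
rewrite -cat1s wcoef_cat IH /wcoef big_cons big_nil /= !xpair_eqE.
case: (u == w); rewrite ?andbF ?add0n ?add0r //= addr0 andbT.
case: b; rewrite /= !add0n natrD.
  by rewrite expr1 opprD addrCA.
by rewrite expr0 addrA.
Qed.

(** The coefficient after setting to zero the variables outside [keep]. *)
Definition kcoef s w : R := wcoef s w * (all keep w)%:R.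

Lemma kcoef_cat s s' w : kcoef (s ++ s') w = kcoef s w + kcoef s' w.
Proof. by rewrite /kcoef wcoef_cat mulrDl. Qed.

Lemma kcoef_neg s w : kcoef (neg s) w = - kcoef s w.
Proof. by rewrite /kcoef wcoef_neg mulNr. Qed.

Lemma kcoef_nil w : kcoef [::] w = 0.
Proof. by rewrite /kcoef /wcoef big_nil mul0r. Qed.

Lemma kcoef_letter i j :
  kcoef [:: (false, [:: i])] [:: j] = ((j == i) && keep i)%:R.
Proof.
rewrite /kcoef /wcoef big_cons big_nil /= eqseq_cons eqxx !andbT addr0 expr0 eq_sym.
by case: eqVneq => [->|_]; rewrite ?mul1r ?mul0r.
Qed.

(** The same word is split at its last letter for [s X_i] and at its first letter for [X_i s]. *)
Lemma kcoef_bracket s i w j w' j' : rcons w j = j' :: w' ->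
  kcoef (bracket s i) (rcons w j) =
    kcoef s w * ((j == i) && keep i)%:R - ((j' == i) && keep i)%:R * kcoef s w'.
Proof.
move=> E; rewrite kcoef_cat kcoef_neg {2}E /kcoef wcoef_rmul wcoef_lmul all_rcons.
congr (_ - _) => /=.
  rewrite mulrAC [_ * wcoef _ _]mulrC -!mulrA; congr (_ * _).
  by case: eqVneq => [->|_]; rewrite ?mul0r ?mulr0 //= mul1r mulrC -natrM mulnb andbC.
rewrite -mulrA; case: eqVneq => [->|_]; rewrite ?mul0r //= !mul1r.
by rewrite mulrCA; congr (_ * _); rewrite -natrM mulnb.
Qed.

End SignedWordCoefficients.

Section WindowMatrices.
Local Open Scope ring_scope.
Variables (R : finComUnitRingType) (k : nat) (I : eqType) (keep : pred I).
Variable v : 'I_k.+2 -> I.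

Definition window a n : seq I := [seq v (inord l) | l <- iota a n].

Lemma window_rcons a n : window a n.+1 = rcons (window a n) (v (inord (a + n))).
Proof. by rewrite /window -[n.+1]addn1 iotaD map_cat /= cats1. Qed.

(** The variable [X_i] acts on a path whose edge from [a] to [a.+1] is labelled [v a]. A product of
    [n] kept letters has entry 1 at [(a, a + n)] exactly when it spells the labels read there, that
    is [window v a n]. *)
Definition letter_mx i : 'M[R]_k.+2 :=
  \matrix_(a, b) ((b == a.+1 :> nat) && ((v a == i) && keep i))%:R.

Lemma upper_letter_mx i : upper 1 (letter_mx i).
Proof. by move=> a b ab; rewrite mxE addn1 ltnS in ab *; rewrite ltn_eqF // ltnS. Qed.

Lemma letter_mx_drop i : ~~ keep i -> letter_mx i = 0.
Proof. by move=> /negPf ki; apply/matrixP => a b; rewrite !mxE ki !andbF. Qed.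

Lemma letter_mx_super i (a b : 'I_k.+2) : b = a.+1 :> nat ->
  letter_mx i a b = ((v (inord a) == i) && keep i)%:R.
Proof. by move=> ab; rewrite mxE ab eqxx inord_val. Qed.

(** Each entry of the [n]-th superdiagonal is the coefficient in [s] of the word spelled by the path
    between its row and its column. *)
Definition lead_sword n (s : sword I) (g : {unit 'M[R]_k.+2}) : Prop :=
  lead n (fun a => kcoef R keep s (window a n)) g.

Lemma lead_swordM n s s' g g' : (0 < n)%N -> lead_sword n s g ->
  lead_sword n s' g' -> lead_sword n (s ++ s') (g * g')%g.
Proof.
move=> n0 lg lg'; apply: eq_lead (leadM n0 lg lg') => a _.
by rewrite kcoef_cat.
Qed.

Lemma lead_swordV n s g : (0 < n)%N -> lead_sword n s g ->
  lead_sword n (neg s) g^-1%g.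
Proof.
by move=> n0 lg; apply: eq_lead (leadV n0 lg) => a _; rewrite kcoef_neg.
Qed.

Lemma lead_sword1 n : (0 < n)%N -> lead_sword n [::] 1%g.
Proof. by move=> n0; apply: eq_lead (lead1 R k n0) => a _; rewrite kcoef_nil. Qed.

Lemma lead_swordJ n s s' g y : (0 < n)%N -> lead_sword n s g ->
  lead_sword 1 s' y -> lead_sword n s (g ^ y)%g.
Proof. by move=> n0 lg ly; apply: leadJ n0 lg ly. Qed.

Lemma lead_sword_bracket n s g i y : (0 < n)%N -> lead_sword n s g ->
  lead_sword 1 [:: (false, [:: i])] y -> lead_sword n.+1 (bracket s i) [~ g, y]%g.
Proof.
move=> n0 lg ly; apply: eq_lead (lead_comm n0 lg ly) => a _ /=.
rewrite !kcoef_letter window_rcons (@kcoef_bracket _ _ _ _ _ _ _ (window a.+1 n) (v (inord a))) //.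
by rewrite -window_rcons.
Qed.

Hypotheses (k_gt0 : (0 < k)%N)
  (fact_unit : forall j, (j <= k)%N -> (j`!)%:R \is a @GRing.unit R).

Definition letter_unit i : {unit 'M[R]_k.+2} :=
  unit_texp fact_unit (upper_letter_mx i).

Lemma lead_letter_unit i : lead_sword 1 [:: (false, [:: i])] (letter_unit i).
Proof.
apply: (lead_texp k_gt0) => a b ab; rewrite kcoef_letter; exact: letter_mx_super.
Qed.

Lemma upper_letter_unitX i m : (keep i -> m%:R = 0 :> R) ->
  upper k.+1 (val (letter_unit i ^+ m)%g - 1).
Proof.
move=> m0; have [ki|/letter_mx_drop X0] := boolP (keep i).
  exact/upper_unit_texpX/m0.
have -> : letter_unit i = 1%g.
  apply: val_inj; rewrite FinRing.val_unit1 /= /mx_texp X0 /texp poly_def rmorph_sum.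
  rewrite big_ord_recl big1 => [|j _] /=.
    by rewrite expr0 linearZ /= invr1 scale1r addr0; apply: rmorph1.
  by rewrite linearZ rmorphXn /= horner_mx_X expr0n scaler0.
rewrite expg1n FinRing.val_unit1 subrr; exact: upper0.
Qed.

End WindowMatrices.

(** * Cyclic groups, quotients, and torsion in the graded quotients *)

Lemma expg_coprime_eq1 (T : groupType) (u : T) m n :
  coprime m n -> u ^+ m = 1 -> u ^+ n = 1 -> u = 1.
Proof.
case: (posnP m) => [->|m0]; first by rewrite /coprime gcd0n => /eqP -> _.
move=> /eqP cmn um un; case: (egcdnP n m0) => a b E _.
have := congr1 (fun l => u ^+ l) E; rewrite cmn addn1 expgS mulnC expgnA um.
by rewrite expg1n mulnC expgnA un expg1n mulg1.
Qed.

Lemma cyclic_hom (C : finGroupType) (T : groupType) (x : C) (z : T) :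
    (forall c, c \in <[x]>) -> z ^+ #[x] = 1 ->
  exists f : {hom C -> T}, f x = z.
Proof.
move=> genx zx.
have zmod m n : x ^+ m = x ^+ n -> z ^+ m = z ^+ n.
  have zr l : z ^+ l = z ^+ (l %% #[x]).
    by rewrite {1}(divn_eq l #[x]) expgnDr mulnC expgnA zx expg1n mul1g.
  by move=> /eqP; rewrite eq_expg_mod_order (zr m) (zr n) => /eqP ->.
have log c : exists n, c == x ^+ n by have /cycleP [n ->] := genx c; exists n.
pose f c := z ^+ xchoose (log c).
have fE n : f (x ^+ n) = z ^+ n by apply/zmod/esym/eqP/(xchooseP (log _)).
have fM : {morph f : a b / a * b}.
  move=> a b; have [/eqP -> /eqP ->] := (xchooseP (log a), xchooseP (log b)).
  by rewrite -expgnDr !fE expgnDr.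
by exists (hom_of fM); rewrite /hom_of /= -[x]expg1 fE.
Qed.

Lemma gen_ind (gT : finGroupType) (A : {set gT}) (P : gT -> Prop) :
  P 1 -> (forall a b, P a -> P b -> P (a * b)) -> (forall a, a \in A -> P a) ->
  forall h, h \in <<A>>%g -> P h.
Proof.
move=> P1 PM PA h /gen_prodgP [n [c cA ->]].
by elim/big_ind: _ => // i _; apply: PA.
Qed.

Lemma first_isomorphism (F Q : groupType) (to_witness : {hom F -> Q})
    (N : normal_subgroup F) : (forall u, exists g, to_witness g = u) ->
  (forall g, to_witness g = 1 <-> normal_set N g) -> group_isomorphic (quotient_group N) Q.
Proof.
move=> to_witness_surj kerpsi.
have psi_eq g g' : quot_map N g = quot_map N g' <-> to_witness g = to_witness g'.
  rewrite quot_map_eqP -kerpsi gmulfM gmulfV; split=> [/mulg1_eq <-|->].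
    by rewrite invgK.
  exact: mulVg.
pose f (u : quotient_group N) := to_witness (generic_quotient.repr u).
have fE g : f (quot_map N g) = to_witness g by apply/psi_eq; rewrite /quot_map reprK.
have fM : {morph f : u v / u * v}.
  move=> u v; have [[g <-] [h <-]] := (quot_map_surj u, quot_map_surj v).
  by rewrite -gmulfM /= !fE gmulfM.
exists (hom_of fM); rewrite /hom_of /=.
have inv u : {w | f w = u}.
  by apply: cid; have [g <-] := to_witness_surj u; exists (quot_map N g).
exists (fun u => sval (inv u)) => u; last by case: (inv u).
case: (inv _) => w /=; have [[g <-] [h <-]] := (quot_map_surj u, quot_map_surj w).
by rewrite !fE => /psi_eq.
Qed.

Section Torsion.
Local Open Scope classical_set_scope.
Variables (G : groupType) (N : nat).
Implicit Types (g h y : G).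
Local Notation gamma := (@lower_central G).
Local Notation q n := (quot_map (lower_centralN G n)).

(** By bilinearity [[~ g, h] ^+ N] agrees with [[~ g ^+ N, h]] one degree deeper, so an exponent of
    the abelianization is one of every graded quotient. *)
Lemma lower_central_torsion : (forall g, gamma 2 (g ^+ N)) ->
  forall n g, gamma n g -> gamma n.+1 (g ^+ N).
Proof.
move=> tor1; case=> [g _|n]; first by [].

elim: n => [//|n IH].
suff: gamma n.+2 `<=` [set g | gamma n.+2 g /\ gamma n.+3 (g ^+ N)].
  by move=> sub g /sub [].
apply: generated_min => [|_ [g [h [Gg _ ->]]]].
  split=> [|g h [Gg Tg] [Gh Th]|g [Gg Tg]] /=.
  - by rewrite expg1n; split; apply: lower_central1.
  - split; first exact: lower_centralM.
    apply/gamma_eq1; rewrite gmulfXn gmulfM expgMn; last exact: gamma_commute.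
    move/gamma_eq1: Tg; move/gamma_eq1: Th; rewrite !gmulfXn /= => -> ->.
    exact: mulg1.
  - by rewrite expVgn; split; apply: lower_centralV.
have {}Gg : gamma n.+1 g by [].
split; first exact: lower_centralRT.
apply/gamma_eq1; rewrite gmulfXn /=.
have := @gammaXR _ n.+1 1 g h N Gg I; rewrite addn1 => <-.
apply/gamma_eq1; apply: lower_centralRT; exact: IH.
Qed.

Lemma lcomm_torsion (I : eqType) (x : I -> G) m y w : gamma m y ->
  gamma m.+1 (y ^+ N) -> gamma (m + size w).+1 (lcomm x y w ^+ N).
Proof.
elim: w m y => [|i w IH] m y Gy Ty; first by rewrite addn0.
rewrite /= addnS -addSn; apply: IH; first exact: lower_centralRT.
apply/gamma_eq1; rewrite gmulfXn /=.
have := @gammaXR _ m 1 y (x i) N Gy Logic.I; rewrite addn1 => <-.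
by apply/gamma_eq1; apply: lower_centralRT.
Qed.

(** Left-normed commutators are multilinear in the graded ring, so the order of any single entry
    kills them. *)
Lemma lnorm_torsion (I : eqType) (x : I -> G) t w : x t ^+ N = 1 -> t \in w ->
  gamma (size w).+1 (lnorm x w ^+ N).
Proof.
move=> xN; case: w => // i w; rewrite inE => /predU1P [<-|tw] /=.
  by apply: (@lcomm_torsion _ _ 1) => //; rewrite xN; apply: lower_central1.
have: gamma 1 (x i) by [].
rewrite -[(size w).+1]add1n; elim: w 1%N (x i) tw => // j w IH m y; rewrite inE => tjw Gy.
rewrite /= -addSnnS; case/predU1P: tjw => [<-|tw]; last first.
  by apply: IH => //; apply: lower_centralRT.
apply: lcomm_torsion; first exact: lower_centralRT.
(* The commutator is inverted to bring [x t] to the left, where [gammaXR] takes powers. *)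
rewrite -(invgR (x t)) expVgn; apply/lower_centralV/gamma_eq1; rewrite gmulfXn /=.
have := @gammaXR _ 1 m (x t) y N Logic.I Gy; rewrite add1n => <-.
by rewrite xN comm1g gmulf1.
Qed.

End Torsion.

(** * A group with central quotient the nilpotent product *)

Section CapabilityWitness.
Variables (I : finType) (alpha : I -> nat) (k p : nat).
Hypotheses (k_gt0 : (0 < k)%N) (p_prime : prime p) (k_lt_p : (k < p)%N).
Hypothesis alpha_gt0 : forall i, (0 < alpha i)%N.

(* A pair (t, v) gives a representation over Z/p^(alpha t), on the path v, in
   which only the letters of exponent at least alpha t survive. *)
Definition path_index : finType := (I * {ffun 'I_k.+2 -> I})%type.
Implicit Type t : path_index.

Definition path_ring t : finComUnitRingType := 'Z_(p ^ alpha t.1).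
Definition kept t : pred I := fun i => (alpha t.1 <= alpha i)%N.

Lemma modulus_gt1 i : (1 < p ^ alpha i)%N.
Proof. by rewrite -(exp1n (alpha i)) ltn_exp2r // prime_gt1. Qed.

Lemma path_fact_unit t j : (j <= k)%N ->
  (j`!)%:R%R \is a @GRing.unit (path_ring t).
Proof.
move=> jk; rewrite unitZpE ?modulus_gt1 // coprimeXl // prime_coprime //.
elim: j jk => [|j IH] jk; first by rewrite fact0 dvdn1 gtn_eqF // prime_gt1.
rewrite factS Euclid_dvdM // negb_or IH ?(ltnW jk) // andbT gtnNdvd //.
exact: leq_ltn_trans k_lt_p.
Qed.

Definition path_group t : finGroupType := {unit 'M[path_ring t]_k.+2}.
Definition path_groups : finGroupType := {dffun forall t, path_group t}.

Definition path_gen i : path_groups :=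
  [ffun t => letter_unit (kept t) t.2 (@path_fact_unit t) i].

Definition witness : {group path_groups} := <<[set path_gen i | i in I]>>%G.

Lemma path_gen_witness i : path_gen i \in witness.
Proof. exact/mem_gen/imset_f. Qed.

Definition witness_gen i : subg_of witness := subg witness (path_gen i).

Definition component t (h : subg_of witness) : path_group t := sgval h t.

Lemma componentM t h h' : component t (h * h') = component t h * component t h'.
Proof. by rewrite /component /= ffunE. Qed.

Lemma component1 t : component t 1 = 1.
Proof. by rewrite /component /= ffunE. Qed.

Lemma componentV t h : component t h^-1 = (component t h)^-1.
Proof. by apply/esym/mulg1_eq; rewrite -componentM mulgV component1. Qed.

Lemma componentX t h n : component t (h ^+ n) = component t h ^+ n.
Proof. by elim: n => [|n IH]; rewrite ?component1 // !expgS componentM IH. Qed.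

Lemma componentR t h h' : component t [~ h, h'] = [~ component t h, component t h'].
Proof. by rewrite /commg /conjg !componentM !componentV. Qed.

Lemma component_inj h h' : (forall t, component t h = component t h') -> h = h'.
Proof. by move=> hh'; apply: val_inj; apply/ffunP => t; apply: hh'. Qed.

Lemma component_gen t i :
  component t (witness_gen i) = letter_unit (kept t) t.2 (@path_fact_unit t) i.
Proof. by rewrite /component /witness_gen subgK ?path_gen_witness // ffunE. Qed.

Lemma witness_ind (P : subg_of witness -> Prop) :
  P 1 -> (forall h h', P h -> P h' -> P (h * h')) ->
  (forall i, P (witness_gen i)) -> forall h, P h.
Proof.
move=> P1 PM Pg h; rewrite -(sgvalK h).
suff [_] : sgval h \in witness /\ P (subg witness (sgval h)) by [].
apply: (gen_ind (P := fun a => a \in witness /\ P (subg witness a))) (subgP h).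
- by split; rewrite ?group1 // -(sgvalK 1%g) in P1.
- move=> a b [wa Pa] [wb Pb]; split; first exact: groupM.
  by rewrite subgM //; apply: PM.
- by move=> _ /imsetP [i _ ->]; split; [exact: path_gen_witness|exact: Pg].
Qed.

Local Notation lead_comp n s h :=
  (forall t, lead_sword (kept t) t.2 n s (component t h)).

Lemma lead_comp_gen i : lead_comp 1 [:: (false, [:: i])] (witness_gen i).
Proof. by move=> t; rewrite component_gen; apply: lead_letter_unit. Qed.

Lemma component_upper t h : upper 1 (val (component t h) - 1)%R.
Proof.
move: h; apply: witness_ind => [|h h' uh uh'|i].
- by rewrite component1; apply: upper_unit1.
- by rewrite componentM; apply: upper_unitM.
- by case: (lead_comp_gen i t).
Qed.

Lemma upper_central h : (forall t, upper k.+1 (val (component t h) - 1)%R) ->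
  center h.
Proof.
move=> uh h'; apply: component_inj => t; rewrite !componentM.
by apply: upper_commute (uh t) (component_upper t h').
Qed.

(** A kept letter has [alpha i] at least [alpha t.1], so [p ^ alpha i] vanishes in the ring and the
    power is 1 up to degree [k]; a dropped letter acts as 1. *)
Lemma witness_genX_central i : center (witness_gen i ^+ (p ^ alpha i)).
Proof.
apply: upper_central => t; rewrite componentX component_gen.
apply: upper_letter_unitX => ki; have [d ->] : exists d, (p ^ alpha i = d * p ^ alpha t.1)%N.
  by exists (p ^ (alpha i - alpha t.1))%N; rewrite -expnD subnK.
by rewrite GRing.natrM [X in (_ * X)%R]pchar_Zp ?modulus_gt1 ?GRing.mulr0.
Qed.

Section Presentation.
Variables (C : I -> finGroupType) (x : forall i, C i).
Hypothesis x_gen : forall i (c : C i), c \in <[x i]>.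
Hypothesis x_order : forall i, #[x i] = (p ^ alpha i)%N.

Local Notation F := (free_product (fun i => C i : groupType)).
Local Notation Q := (quotient_group (centerN (subg_of witness))).
Local Notation qmap := (quot_map (centerN (subg_of witness))).
Local Notation gamma := (@lower_central F).

Lemma letter_hom_ex i : exists f : {hom C i -> Q}, f (x i) = qmap (witness_gen i).
Proof.
apply: cyclic_hom; first exact: x_gen.
rewrite x_order -gmulfXn; apply/quot_map_eq1; exact: witness_genX_central.
Qed.

Definition letter_hom i := projT1 (cid (letter_hom_ex i)).

Lemma letter_homE i : letter_hom i (x i) = qmap (witness_gen i).
Proof. exact: (projT2 (cid (letter_hom_ex i))). Qed.

Definition to_witness : {hom F -> Q} := fp_lift letter_hom.

Definition gen_letter i : F := letter (A := fun i => C i : groupType) (x i).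

Lemma to_witness_gen i : to_witness (gen_letter i) = qmap (witness_gen i).
Proof. by rewrite /to_witness /gen_letter /= fp_lift_letter letter_homE. Qed.

Lemma free_product_cyclic_ind (S : F -> Prop) : is_subgroup S ->
  (forall i, S (gen_letter i)) -> forall g, S g.
Proof.
move=> sS Sx; apply: free_product_ind => // i c.
have /cycleP [n ->] := x_gen c; rewrite gmulfXn.
by apply: subgroupX => //; apply: Sx.
Qed.

Lemma to_witness_surj u : exists g, to_witness g = u.
Proof.
have [h <-] := quot_map_surj u; move: h; apply: witness_ind.
- by exists 1; rewrite !gmulf1.
- by move=> h h' [g pg] [g' pg']; exists (g * g'); rewrite !gmulfM pg pg'.
- by move=> i; exists (gen_letter i); apply: to_witness_gen.
Qed.

(** One polynomial [s] describes both [g] in the graded Lie ring of the free product and the leading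
    term, in every path representation, of a lift [h] of its image. *)
Definition graded_lift n g := gamma n g /\ exists s h,
  [/\ Lie_symbol gen_letter n s g, to_witness g = qmap h & lead_comp n s h].

Lemma graded_lift_subgroup n : (0 < n)%N -> is_subgroup (graded_lift n).
Proof.
move=> n0; split.
- split; first exact: lower_central1.
  exists [::], 1; split; rewrite ?gmulf1 //; first exact: Lie_symbol1.
  by move=> t; rewrite component1; apply: lead_sword1.
- move=> g g' [Gg [s [h [Sg pg Lh]]]] [Gg' [s' [h' [Sg' pg' Lh']]]].
  split; first exact: lower_centralM.
  exists (s ++ s'), (h * h'); split; first exact: Lie_symbolM.
    by rewrite !gmulfM pg pg'.
  by move=> t; rewrite componentM; apply: lead_swordM.
- move=> g [Gg [s [h [Sg pg Lh]]]]; split; first exact: lower_centralV.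
  exists (neg s), h^-1; split; first exact: Lie_symbolV.
    by rewrite !gmulfV pg.
  by move=> t; rewrite componentV; apply: lead_swordV.
Qed.

Lemma graded_lift1 g : graded_lift 1 g.
Proof.
move: g; apply: free_product_cyclic_ind; first exact: graded_lift_subgroup.
move=> i; split=> //; exists [:: (false, [:: i])], (witness_gen i).
by split; [exact: Lie_symbol_gen|exact: to_witness_gen|exact: lead_comp_gen].
Qed.

Lemma graded_liftJ n g y : (0 < n)%N -> graded_lift n g -> graded_lift n (g ^ y).
Proof.
move=> n0 [Gg [s [h [Sg pg Lh]]]]; split; first exact: lower_centralJ.
have [_ [s' [h' [_ py Ly]]]] := graded_lift1 y.
exists s, (h ^ h'); split; first exact: Lie_symbolJ.
  by rewrite !gmulfJ pg py.
move=> t; rewrite /conjg !componentM componentV; exact: lead_swordJ (Ly t).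
Qed.

(** The elements with a graded lift form a subgroup stable under conjugation, so in a commutator
    [[~ g, y]] the entry [y] may be taken to be a generator; there the symbol is [bracket s i]. *)
Lemma graded_lift_lower_central n g : (0 < n)%N -> gamma n g -> graded_lift n g.
Proof.
case: n => // n _; elim: n g => [|n IH] g; first by move=> _; apply: graded_lift1.
move: g; apply: generated_min; first exact: graded_lift_subgroup.
move=> _ [g [y [/IH Lg _ ->]]].
have [gl1 glM glV] := graded_lift_subgroup (ltn0Sn n.+1).
move: y; apply: free_product_cyclic_ind; first split=> /=.
- by rewrite commg1.
- by move=> y z Ly Lz; rewrite commgM; apply: glM => //; apply: graded_liftJ.
- by move=> y Ly; rewrite commgV; apply: graded_liftJ => //; apply: glV.
move=> i; have [Gg [s [h [Sg pg Lh]]]] := Lg.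
split; first exact: lower_centralRT.
exists (bracket s i), [~ h, witness_gen i]; split.
- exact: Lie_symbol_bracket.
- by rewrite !gmulfR /= pg to_witness_gen.
- move=> t; rewrite componentR; apply: lead_sword_bracket => //.
  exact: lead_comp_gen.
Qed.

(** A lift of the image is 1 up to degree [k], hence central. *)
Lemma to_witness_lower_central g : gamma k.+1 g -> to_witness g = 1.
Proof.
move=> /(graded_lift_lower_central (ltn0Sn k)) [_ [s [h [_ -> Lh]]]].
by apply/quot_map_eq1/upper_central => t; case: (Lh t).
Qed.

(** The commutator of [h] with the generator [i] is trivial, yet its leading term is given by
    [bracket s i]. As [n.+1] is at most [k.+1], the coefficient of [w] is an entry of the first row
    for a suitable path. *)
Lemma central_kcoef n s h t i w : (0 < n)%N -> center h -> lead_comp n s h ->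
  size w = n.+1 -> (n <= k)%N -> kcoef (path_ring t) (kept t) (bracket s i) w = 0%R.
Proof.
move=> n0 Zh Lh sw nk.
(* A path spelling [w] from its origin, padded with [i]. *)
pose v : {ffun 'I_k.+2 -> I} := [ffun l : 'I_k.+2 => nth i w l].
pose tv : path_index := (t.1, v).
have : lead_sword (kept tv) v n.+1 (bracket s i) (1 : path_group tv).
  have -> : 1 = component tv [~ h, witness_gen i].
    by have /commgP/eqP -> := Zh (witness_gen i); rewrite component1.
  rewrite componentR; apply: lead_sword_bracket => //.
  exact: (lead_comp_gen i tv).
have nk2 : (n.+1 < k.+2)%N by rewrite !ltnS.
case=> _ /(_ ord0 (Ordinal nk2) (esym (add0n _))) E.
have -> : w = window v 0 n.+1.
  apply: (@eq_from_nth _ i) => [|l]; first by rewrite size_map size_iota.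
  rewrite sw => ln; rewrite (nth_map 0%N) ?size_iota // nth_iota // add0n ffunE.
  by rewrite inordK //; apply: leq_trans ln _; apply: leqW.
by apply: etrans (esym E) _; rewrite FinRing.val_unit1 mxE.
Qed.

Variables (top pen : I).
Hypotheses (pen_top : pen != top) (alpha_top : forall i, (alpha i <= alpha top)%N).
Hypothesis alpha_pen : alpha pen = alpha top.

Section CentralCoefficients.
Variables (n : nat) (s : sword I) (h : subg_of witness) (t : path_index).
Hypotheses (n0 : (0 < n)%N) (nk : (n <= k)%N) (Zh : center h).
Hypothesis Lh : lead_comp n s h.
Local Notation coef := (wcoef (path_ring t) s).

(* The coefficients of the word u i in s X_i and X_i s agree. *)
Let coef_rotate i j u w : size u = n -> all (kept t) u -> kept t i ->
  rcons u i = j :: w -> coef u = ((j == i)%:R * coef w)%R.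
Proof.
move=> su ku ki E; have := @central_kcoef n s h t i (rcons u i) n0 Zh Lh.
rewrite size_rcons su => /(_ erefl nk).
rewrite (kcoef_bracket _ _ _ _ E) ki eqxx !andbT GRing.mulr1 => /eqP.
rewrite GRing.subr_eq0 => /eqP; rewrite /kcoef ku GRing.mulr1 => ->.
suff -> : all (kept t) w by rewrite GRing.mulr1.
have : all (kept t) (rcons u i) by rewrite all_rcons ki.
by rewrite E => /andP [].
Qed.

Let kept_top : kept t top. Proof. exact: alpha_top. Qed.

(** Rotation with [top] moves the leading letters [top] to the end without changing the coefficient,
    until [a] comes first; one more rotation then gives 0. *)
Let coef_top_prefix j a w : a != top -> (j + (size w).+1)%N = n ->
  all (kept t) (nseq j top ++ a :: w) -> coef (nseq j top ++ a :: w) = 0%R.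
Proof.
move=> atop; elim: j w => [|j IH] w sw kw.
  rewrite (@coef_rotate top a _ (rcons w top)) //.
  by rewrite (negPf atop) GRing.mul0r.
rewrite (@coef_rotate top top _ (nseq j top ++ a :: rcons w top)) //.
- rewrite IH ?GRing.mulr0 //; first by rewrite size_rcons -sw addSnnS.
  move: kw; rewrite /= !all_cat /= all_rcons kept_top => /andP [_ /and3P [-> -> ->]].
  by [].
- by rewrite /= size_cat size_nseq /= -sw.
- by rewrite /= rcons_cat.
Qed.

(** A word with a letter other than [top] is covered by [coef_top_prefix]. A power of [top] is
    handled by rotation with [pen], which is kept because [alpha pen = alpha top]. *)
Lemma central_coef u : size u = n -> all (kept t) u -> coef u = 0%R.
Proof.
move=> su ku; have [utop|] := boolP (all (pred1 top) u).
  case: u su ku utop => [|a u] su ku; first by move: n0; rewrite -su.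
  move=> /= /andP [/eqP atop _].
  rewrite (@coef_rotate pen a _ (rcons u pen)) //; last by rewrite /kept alpha_pen.
  by rewrite atop eq_sym (negPf pen_top) GRing.mul0r.
rewrite -has_predC => hu; case: (split_find_nth top hu) su ku => a u1 u2 atop.
rewrite has_predC negbK cat_rcons => /all_pred1P -> su ku.
by apply: coef_top_prefix ku; rewrite // -su size_cat size_nseq.
Qed.

End CentralCoefficients.

Lemma letter_order i : gen_letter i ^+ (p ^ alpha i) = 1.
Proof. by rewrite -gmulfXn -x_order expg_order gmulf1. Qed.

Lemma free_product_torsion g : gamma 2 (g ^+ (p ^ alpha top)).
Proof.
move: g; apply: free_product_cyclic_ind; first split.
- by rewrite expg1n; apply: lower_central1.
- move=> g h Tg Th; apply/gamma_eq1.
  rewrite gmulfXn gmulfM expgMn; last exact: gamma_commute.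
  move/gamma_eq1: Tg; move/gamma_eq1: Th; rewrite !gmulfXn /= => -> ->.
  exact: mulg1.
- by move=> g Tg; rewrite expVgn; apply: lower_centralV.
- move=> i; rewrite -(subnK (alpha_top i)) expnD mulnC expgnA letter_order expg1n.
  exact: lower_central1.
Qed.

(** The element is pushed down the lower central series one term at a time. In each graded quotient
    it is killed by its degree, through the Dynkin map, and by a power of [p]; these are coprime. *)
Lemma to_witness_eq1 g : to_witness g = 1 -> gamma k.+1 g.
Proof.
move=> pg; suff: forall n, (n <= k)%N -> gamma n.+1 g by apply.
elim=> [//|n IH] nk; have Gg := IH (ltnW nk).
have [_ [s [h [[hs _ Ds] ph Lh]]]] := graded_lift_lower_central (ltn0Sn n) Gg.
have Zh : center h by apply/(quot_map_eq1 (centerN (subg_of witness))); rewrite -ph.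
apply/gamma_eq1; apply: (@expg_coprime_eq1 _ _ n.+1 (p ^ alpha top)).
- rewrite coprime_sym coprimeXl // prime_coprime // gtnNdvd //.
  exact: leq_ltn_trans k_lt_p.
- rewrite -gmulfXn /= -Ds; apply/gamma_eq1.
  apply: (evalw_gamma_eq1 (n := n.+1)) => //; first by move=> w <-; apply: lnorm_gamma.
  case=> [//|i w] sw.
  (* For a letter [t] of least exponent in the word, [p ^ alpha t] kills the left-normed commutator,
     and every letter of the word is kept over the integers modulo [p ^ alpha t], where the
     coefficient vanishes. *)
  have [t tw tmin] : exists2 t, t \in i :: w & all (fun j => alpha t <= alpha j)%N (i :: w).
    case: (arg_minnP alpha (mem_head i w)) => t tw tmin.
    by exists t => //; apply/allP => j /tmin.
  exists (p ^ alpha t)%N.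
    by rewrite -sw; apply: lnorm_torsion tw; apply: letter_order.
  pose tv : path_index := (t, [ffun=> t]).
  have := @central_coef _ s h tv (ltn0Sn n) nk Zh Lh _ sw tmin.
  rewrite wcoef_count => /eqP; rewrite GRing.subr_eq0 => /eqP E.
  have {}E : ((count_mem (false, i :: w) s)%:R)%R =
             ((count_mem (true, i :: w) s)%:R)%R :> 'Z_(p ^ alpha t) := E.
  by have := congr1 val E; rewrite /= !val_Zp_nat ?modulus_gt1.
- rewrite -gmulfXn; apply/gamma_eq1; apply: lower_central_torsion Gg.
  exact: free_product_torsion.
Qed.

Lemma capable_nilpotent_product_if :
  capable (nilpotent_product k (fun i => C i : groupType)).
Proof.
exists (subg_of witness); apply: (first_isomorphism (to_witness := to_witness)).
  exact: to_witness_surj.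
move=> g; split; first exact: to_witness_eq1.
exact: to_witness_lower_central.
Qed.

End Presentation.
End CapabilityWitness.

Theorem theorem4p5 (k p r : nat) (C : 'I_r -> finGroupType)
    (x : forall i : 'I_r, C i) (alpha : 'I_r -> nat)
    (k_gt0 : (0 < k)%N) (p_prime : prime p) (k_lt_p : (k < p)%N)
    (r_gt0 : (0 < r)%N)
    (x_gen : forall i : 'I_r, [set: C i] = <[x i]>)
    (x_order : forall i : 'I_r, #[x i] = (p ^ alpha i)%N)
    (alpha_gt0 : forall i : 'I_r, (1 <= alpha i)%N)
    (alpha_mono : forall i j : 'I_r, (i <= j)%N -> (alpha i <= alpha j)%N) :
  capable (nilpotent_product k (fun i : 'I_r => C i : groupType)) <->
  ((1 < r)%N /\
   (forall i j : 'I_r, i.+2 = r -> j.+1 = r -> alpha i = alpha j)).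
Proof.
have gen i (c : C i) : c \in <[x i]> by rewrite -x_gen inE.
split; first by apply: (capable_nilpotent_product_only_if k_gt0 p_prime k_lt_p).
case: r C x alpha r_gt0 x_gen x_order alpha_gt0 alpha_mono gen => [|[|r]].
- by [].
- by move=> C x alpha _ _ _ _ _ _ [].
move=> C x alpha _ _ x_order alpha_gt0 alpha_mono gen [_ alpha_eq].
(* There are now [r.+2] factors; [pen] has value [r] and [ord_max] has value [r.+1]. *)
pose pen : 'I_r.+2 := Ordinal (ltnW (ltnSn r.+1)).
apply: (capable_nilpotent_product_if k_gt0 p_prime k_lt_p alpha_gt0 gen x_order
          (top := ord_max) (pen := pen)).
- by rewrite -val_eqE /= neq_ltn ltnSn.
- by move=> i; apply: alpha_mono; rewrite -ltnS; apply: ltn_ord.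
- exact: alpha_eq.
Qed.
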